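(* Let $\mathcal{K}\subseteq\mathbb{R}^d$ be nonempty, convex and compact, with diameter $D=\max_{x,y\in\mathcal{K}}\|x-y\|$. Assume: (i) $|\tilde F(x;z)|\le B$ for all $x\in\mathcal{K}$, $z\in\mathcal{Z}$; (ii) $\|\nabla\tilde F(x;z)\|\le G_{\tilde F}$ for all $x\in\mathcal{K}$, $z\in\mathcal{Z}$, and $\mathbb{E}_{z\sim p(z;x)}\|\nabla\log p(z;x)\|^4\le G_p^4$ for all $x\in\mathcal{K}$; put $G=\max\{G_{\tilde F},G_p\}$; (iii) $\|\nabla^2\tilde F(x;z)\|\le L_{\tilde F}$ for all $x\in\mathcal{K}$, $z\in\mathcal{Z}$, and $\mathbb{E}_{z\sim p(z;x)}\|\nabla^2\log p(z;x)\|^2\le L_p^2$ for all $x\in\mathcal{K}$ (spectral norms); put $L=\max\{L_{\tilde F},L_p\}$. Let $\bar L=\left(4B^2G^4+16G^4+4L^2+4B^2L^2\right)^{1/2}$. ($F$ need not be convex.) Run the one-sample stochastic Frank-Wolfe method (1-SFW) with the exact Hessian option and the minimization update, for $T\ge1$ iterations, with $\rho_t=(t-1)^{-2/3}$ (for $t\ge2$) and $\eta_t=T^{-2/3}$, and let the output $x_o$ be chosen uniformly at random from $\{x_1,\dots,x_T\}$ (uniform index, independent of everything else). Then $x_o\in\mathcal{K}$ and $$\mathbb{E}[\mathcal{G}(x_o)]\le\frac{2B+\tfrac32\sqrt{C}D}{T^{1/3}}+\frac{\bar LD^2}{2T^{2/3}},$$ where $\mathcal{G}(x)=\max_{v\in\mathcal{K}}\langle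 v-x,-\nabla F(x)\rangle$ is the Frank-Wolfe gap and $$C=\max\left\{\frac{2(2G+D\bar L)^2}{\frac43-2^{-2/3}},\ \left[\frac{2}{\frac43-2^{-2/3}}\right]^4,\ [2D(\bar L+L)]^4\right\}.$$
   Context: Problem (non-oblivious stochastic optimization): $F:\mathbb{R}^d\to\mathbb{R}$, $F(x)=\mathbb{E}_{z\sim p(z;x)}[\tilde F(x;z)]$, where $\tilde F:\mathbb{R}^d\times\mathcal{Z}\to\mathbb{R}$ and, for each $x$, $p(\cdot;x)$ is a probability density on $\mathcal{Z}$ which may depend on $x$. Gradients $\nabla$ and Hessians $\nabla^2$ are with respect to $x$; $\|\cdot\|$ is the Euclidean norm for vectors and the spectral norm for matrices. Hessian estimator: $$\tilde\nabla^2F(x;z)=\tilde F(x;z)[\nabla\log p(z;x)][\nabla\log p(z;x)]^\top+\nabla^2\tilde F(x;z)+[\nabla\tilde F(x;z)][\nabla\log p(z;x)]^\top+\tilde F(x;z)\nabla^2\log p(z;x)+[\nabla\log p(z;x)][\nabla\tilde F(x;z)]^\top.$$ Standing assumptions: $F$, $\tilde F(\cdot;z)$ and $\log p(z;\cdot)$ are twice continuously differentiable, all functions are measurable in $z$, and for all $x\in\mathcal{K}$ the estimators are unbiased: $\mathbb{E}_{z\sim p(z;x)}[\nabla\tilde F(x;z)]=\nabla F(x)$ and $\mathbb{E}_{z\sim p(z;x)}[\tilde\nabla^2F(x;z)]=\nabla^2F(x)$. Algorithm 1-SFW (exact Hessian option, minimization update). Input: $\rho_t,\eta_t\in(0,1]$,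 a deterministic initial point $x_1\in\mathcal{K}$, number of iterations $T$. For $t=1,\dots,T$: - If $t=1$: sample $z_1\sim p(\cdot;x_1)$ and set $d_1=\nabla\tilde F(x_1;z_1)$. - If $t\ge2$: draw $a$ uniformly from $[0,1]$ independently of the past; set $x_t(a)=ax_t+(1-a)x_{t-1}$; sample (conditionally on the past and $a$) $z_t\sim p(\cdot;x_t(a))$; set $\tilde\Delta_t=\tilde\nabla^2F(x_t(a);z_t)\,(x_t-x_{t-1})$ and $d_t=(1-\rho_t)(d_{t-1}+\tilde\Delta_t)+\rho_t\nabla\tilde F(x_t;z_t)$. - Update: $v_t\in\arg\min_{v\in\mathcal{K}}v^\top d_t$ (measurably selected), $x_{t+1}=x_t+\eta_t(v_t-x_t)$. The expectation is over all randomness of the algorithm, including the choice of $x_o$. *)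

(* Defs.v *)
(* MathComp / MathComp-Analysis *)
From HB Require Import structures.
From mathcomp Require Import all_boot all_order all_algebra.
From mathcomp Require Import all_classical all_reals all_analysis.

Set Implicit Arguments.
Unset Strict Implicit.
Unset Printing Implicit Defensive.

Import Order.TTheory GRing.Theory Num.Theory.
Import numFieldNormedType.Exports.

Local Open Scope classical_set_scope.
Local Open Scope ring_scope.

Section euclidean_space.
Context {R : realType} {d : nat}.
Implicit Types (u v x : 'cV[R]_d) (A : 'M[R]_d) (K : set 'cV[R]_d).
Implicit Types f : 'cV[R]_d -> R.

Definition dotp u v : R := \sum_i u i 0 * v i 0.

(* The library norm on matrices is the sup norm of the entries, hence the
   separate Euclidean and spectral norms. *)
Definition enorm u : R := Num.sqrt (dotp u u).

Definition specnorm A : R := sup [set enorm (A *m u) | u in [set u | enorm u <= 1]].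

(* In diameter and fw_gap below the supremum is a maximum when K is nonempty and
   compact. *)
Definition diameter K : R :=
  sup [set enorm (xy.1 - xy.2) | xy in K `*` K].

Definition grad f x : 'cV[R]_d := \col_i 'D_(delta_mx i 0) f x.

Definition hess f x : 'M[R]_d :=
  \matrix_(i, j) 'D_(delta_mx j 0) (fun y => grad f y i 0) x.

Definition twice_cont_diff f : Prop :=
  [/\ forall x, differentiable f x,
      forall x, differentiable (grad f) x &
      continuous (hess f)].

Definition linear_argmin K u : set 'cV[R]_d :=
  [set v | K v /\ forall w, K w -> dotp v u <= dotp w u].

Definition fw_gap K f x : R := sup [set dotp (v - x) (- grad f x) | v in K].

End euclidean_space.

Definition mx_measurable_fun d0 (T : measurableType d0) (R : realType)
    (m n : nat) (X : T -> 'M[R]_(m, n)) : Prop :=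
  forall i j, measurable_fun setT (fun w => X w i j).

Section densities.
Context {R : realType} {dZ : measure_display} {Z : measurableType dZ}.
Variable mu : {measure set Z -> \bar R}.
Implicit Types q : Z -> R.

Definition density_law q (A : set Z) : \bar R := (\int[mu]_(z in A) (q z)%:E)%E.

Definition density_expectation q (h : Z -> R) : \bar R :=
  (\int[mu]_z (h z * q z)%:E)%E.

Definition has_mean q (h : Z -> R) (m : R) : Prop :=
  mu.-integrable setT (fun z => (h z * q z)%:E) /\
  density_expectation q h = m%:E.

Definition has_mean_mx q (k l : nat) (h : Z -> 'M[R]_(k, l)) (M : 'M[R]_(k, l)) :
  Prop := forall i j, has_mean q (fun z => h z i j) (M i j).

End densities.

Section model.
Context {R : realType} {d : nat} {dZ : measure_display} {Z : measurableType dZ}.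
Variable mu : {measure set Z -> \bar R}.
Variables (Ft : 'cV[R]_d -> Z -> R) (p : Z -> 'cV[R]_d -> R).

Definition logp (z : Z) (x : 'cV[R]_d) : R := ln (p z x).

Definition hess_estimator (x : 'cV[R]_d) (z : Z) : 'M[R]_d :=
  let g := grad (Ft^~ z) x in
  let s := grad (logp z) x in
  Ft x z *: (s *m s^T) + hess (Ft^~ z) x + g *m s^T
    + Ft x z *: hess (logp z) x + s *m g^T.

Record nonoblivious_model (K : set 'cV[R]_d) (F : 'cV[R]_d -> R) : Prop := {
  (* log p(z; .) being a real-valued function on the whole space, the density
     never vanishes *)
  density_gt0 : forall z x, 0 < p z x;
  density_mass1 : forall x, density_law mu (p^~ x) setT = 1%E;
  objectiveE : forall x, has_mean mu (p^~ x) (Ft x) (F x);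
  objective_C2 : twice_cont_diff F;
  Ft_C2 : forall z, twice_cont_diff (Ft^~ z);
  logp_C2 : forall z, twice_cont_diff (logp z);
  Ft_measurable : forall x, measurable_fun setT (Ft x);
  density_measurable : forall x, measurable_fun setT (p^~ x);
  grad_Ft_measurable : forall x, mx_measurable_fun (fun z => grad (Ft^~ z) x);
  hess_Ft_measurable : forall x, mx_measurable_fun (fun z => hess (Ft^~ z) x);
  grad_logp_measurable : forall x, mx_measurable_fun (fun z => grad (logp z) x);
  hess_logp_measurable : forall x, mx_measurable_fun (fun z => hess (logp z) x);
  grad_unbiased : forall x, K x ->
    has_mean_mx mu (p^~ x) (fun z => grad (Ft^~ z) x) (grad F x);
  hess_unbiased : forall x, K x ->
    has_mean_mx mu (p^~ x) (hess_estimator x) (hess F x)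
}.

End model.

Section algorithm.
Context {R : realType} {d : nat} {dZ : measure_display} {Z : measurableType dZ}.
Context {dO : measure_display} {Omega : measurableType dO}.
Variable P : probability Omega R.
Variables (a : nat -> {RV P >-> R}) (z : nat -> {RV P >-> Z}).
Variable v : nat -> Omega -> 'cV[R]_d.

Definition events_of d' (U : measurableType d') (X : Omega -> U) :
  set (set Omega) := preimage_set_system setT X measurable.

(* The sigma-algebra generated by all the random choices made in iterations
   1, ..., t: the samples z_s, the draws a_s (there is none at s = 1), and the
   selected minimizers v_s, which may thus involve extra randomness. *)
Definition history (t : nat) : set (set Omega) :=
  <<s [set E | exists s : nat,
         [\/ (1 <= s <= t)%N /\ events_of (z s) E,
             (2 <= s <= t)%N /\ events_of (a s) E |
             (1 <= s <= t)%N /\ exists i, events_of (fun w => v s w i 0) E] ] >>.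

Definition history_draw (t : nat) : set (set Omega) :=
  <<s history t.-1 `|` events_of (a t) >>.

Variable mu : {measure set Z -> \bar R}.
Variables (Ft : 'cV[R]_d -> Z -> R) (p : Z -> 'cV[R]_d -> R).
Variables (K : set 'cV[R]_d) (x1 : 'cV[R]_d) (rho eta : nat -> R) (T : nat).
Variables x g : nat -> Omega -> 'cV[R]_d.

Definition interp_point (t : nat) (w : Omega) : 'cV[R]_d :=
  a t w *: x t w + (1 - a t w) *: x t.-1 w.

(* A run of T iterations of 1-SFW with the exact Hessian option and the
   minimization update; g t is the gradient estimate of iteration t. *)
Record sfw_run : Prop := {
  run_x1 : forall w, x 1%N w = x1;
  run_z1 : forall B, measurable B -> P (z 1%N @^-1` B) = density_law mu (p^~ x1) B;
  run_g1 : forall w, g 1%N w = grad (Ft^~ (z 1%N w)) x1;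
  run_a_uniform : forall t, (2 <= t <= T)%N -> forall B, measurable B ->
    P (a t @^-1` B) = uniform_prob (@ltr01 R) B;
  run_a_indep : forall t, (2 <= t <= T)%N ->
    forall E B, history t.-1 E -> measurable B ->
    P (E `&` a t @^-1` B) = (P E * P (a t @^-1` B))%E;
  (* p(.; x_t(a)) is the conditional law of z_t given the past and a_t *)
  run_z : forall t, (2 <= t <= T)%N ->
    forall E B, history_draw t E -> measurable B ->
    P (E `&` z t @^-1` B) =
      (\int[P]_(w in E) density_law mu (p^~ (interp_point t w)) B)%E;
  run_g : forall t, (2 <= t <= T)%N -> forall w,
    g t w = (1 - rho t) *:
              (g t.-1 w +
               hess_estimator Ft p (interp_point t w) (z t w)
                 *m (x t w - x t.-1 w))
            + rho t *: grad (Ft^~ (z t w)) (x t w);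
  run_v_measurable : forall t, (1 <= t <= T)%N -> mx_measurable_fun (v t);
  run_v : forall t, (1 <= t <= T)%N -> forall w, linear_argmin K (g t w) (v t w);
  run_x : forall t, (1 <= t <= T)%N -> forall w,
    x t.+1 w = x t w + eta t *: (v t w - x t w)
}.

Record uniform_output_index (o : {RV P >-> nat}) : Prop := {
  output_range : forall w, (1 <= o w <= T)%N;
  output_uniform : forall t, (1 <= t <= T)%N ->
    P (o @^-1` [set t]) = (T%:R^-1)%:E;
  output_indep : forall E (B : set nat), history T E ->
    P (E `&` o @^-1` B) = (P E * P (o @^-1` B))%E
}.

End algorithm.

(* Main.v *)
Require Import Defs.
From HB Require Import structures.
From mathcomp Require Import all_boot all_order all_algebra.
From mathcomp Require Import all_classical all_reals all_analysis.
From mathcomp Require Import measurable_realfun zify ring lra.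
Import Order.TTheory GRing.Theory Num.Theory.
Import numFieldNormedType.Exports.
Local Open Scope classical_set_scope.
Local Open Scope ring_scope.

(** The proof controls the error e_t = g_t - grad F(x_t) of the gradient estimate and
    shows that its mean square is at most C t^(-2/3); the bound on the gap then follows
    from the usual analysis of Frank-Wolfe steps.

    - Moments of the estimators. Expanding the Hessian estimator into its rank-one
      terms bounds the second moment of its action on a vector u by Lbar^2 |u|^2
      (hess_estimator_mean_sqr). As the Hessian of F is the mean of the estimator, grad F
      is Lbar-Lipschitz on K, and F satisfies the descent inequality with this constant.

    - One iteration. Given the past, e_t = (1 - rho_t) (e_{t-1} + V) + rho_t Y,
      where V is an estimated Hessian-vector product minus the increment of grad F. It is
      centered, because the Hessian-vector product at a uniform point of a segment has the
      increment of the gradient along it as mean (hess_line_mean). The noise Y of the new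
      gradient has a bias, since the sample is drawn at the random point of the segment
      and not at x_t; this bias is at most (L + Lbar) |x_t - x_{t-1}|. Hence, with
      r^2 a bound on the mean square of e_{t-1} (one_step_bound, grad_error_step), the
      mean square of e_t is at most
        (1 - rho_t)^2 r^2 + 2 (1 - rho_t) rho_t r (L + Lbar) D eta_t
          + rho_t^2 (2 G + D Lbar)^2,
      and C is chosen so that the rate C t^(-2/3) is stable under this recursion
      (error_rate_step, grad_error_mean_sqr).

    - Integration over the past. The hypotheses on a run speak of events: independence of
      the uniform draw from the past, conditional law of the sample. They are turned into
      iterated integrals by a disintegration formula (disintegration), which requires
      joint measurability of all functions of a point and a sample. These functions are
      continuous in the point and measurable in the sample, hence jointly measurable
      (caratheodory_measurable).

    - The gap. At each iteration the gap is at most (F(x_t) - F(x_{t+1})) / eta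
      + D |e_t| + (Lbar / 2) eta D^2 (fw_gap_le). The output index is independent of the
      run, so that the expected gap at x_o is the average of the expected gaps; the values
      of F telescope and the sum of t^(-1/3) up to T is at most (3/2) T^(2/3). *)

Set Implicit Arguments.
Unset Strict Implicit.
Unset Printing Implicit Defensive.

(** * Euclidean and spectral norms *)

Section euclidean_norm.
Context {R : realType} {d : nat}.
Implicit Types (u v w : 'cV[R]_d) (A : 'M[R]_d) (c : R).

Lemma dotpC u v : dotp u v = dotp v u.
Proof. by rewrite /dotp; apply: eq_bigr => i _; rewrite mulrC. Qed.

Lemma dotpDl u v w : dotp (u + v) w = dotp u w + dotp v w.
Proof.
by rewrite /dotp -big_split/=; apply: eq_bigr => i _; rewrite mxE mulrDl.
Qed.

Lemma dotpZl c u v : dotp (c *: u) v = c * dotp u v.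
Proof. by rewrite /dotp mulr_sumr; apply: eq_bigr => i _; rewrite mxE mulrA. Qed.

Lemma dotpDr u v w : dotp w (u + v) = dotp w u + dotp w v.
Proof. by rewrite dotpC dotpDl ![dotp w _]dotpC. Qed.

Lemma dotpZr c u v : dotp u (c *: v) = c * dotp u v.
Proof. by rewrite dotpC dotpZl dotpC. Qed.

Lemma dotpNl u v : dotp (- u) v = - dotp u v.
Proof. by rewrite -scaleN1r dotpZl mulN1r. Qed.

Lemma dotpNr u v : dotp u (- v) = - dotp u v.
Proof. by rewrite dotpC dotpNl dotpC. Qed.

Lemma dotpBl u v w : dotp (u - v) w = dotp u w - dotp v w.
Proof. by rewrite dotpDl dotpNl. Qed.

Lemma dotpBr u v w : dotp w (u - v) = dotp w u - dotp w v.
Proof. by rewrite dotpDr dotpNr. Qed.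

Lemma dotp0l u : dotp 0 u = 0.
Proof. by rewrite -(scale0r 0) dotpZl mul0r. Qed.

Lemma dotp_ge0 u : 0 <= dotp u u.
Proof. by apply: sumr_ge0 => i _; rewrite -expr2 sqr_ge0. Qed.

Lemma dotp_eq0 u : dotp u u = 0 -> u = 0.
Proof.
move=> /eqP; rewrite psumr_eq0; last by move=> i _; rewrite -expr2 sqr_ge0.
move=> /allP u0; apply/colP => i; rewrite mxE.
by have := u0 i (mem_index_enum _); rewrite /= -expr2 sqrf_eq0 => /eqP.
Qed.

Lemma enorm_ge0 u : 0 <= enorm u.
Proof. exact: sqrtr_ge0. Qed.

Lemma enorm_sqr u : enorm u ^+ 2 = dotp u u.
Proof. by rewrite sqr_sqrtr// dotp_ge0. Qed.

Lemma enorm_sqrD u v :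
  enorm (u + v) ^+ 2 = enorm u ^+ 2 + 2 * dotp u v + enorm v ^+ 2.
Proof. by rewrite !enorm_sqr dotpDl !dotpDr (dotpC v u); ring. Qed.

Lemma enorm_sqrB u v :
  enorm (u - v) ^+ 2 = enorm u ^+ 2 - 2 * dotp v u + enorm v ^+ 2.
Proof. by rewrite !enorm_sqr dotpBl !dotpBr (dotpC v u); ring. Qed.

Lemma enorm0 : enorm (0 : 'cV[R]_d) = 0.
Proof. by rewrite /enorm dotp0l sqrtr0. Qed.

Lemma enorm_eq0 u : enorm u = 0 -> u = 0.
Proof. by move=> u0; apply: dotp_eq0; rewrite -enorm_sqr u0 expr0n. Qed.

Lemma enormN u : enorm (- u) = enorm u.
Proof. by rewrite /enorm dotpNl dotpNr opprK. Qed.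

Lemma enormZ c u : enorm (c *: u) = `|c| * enorm u.
Proof.
by rewrite /enorm dotpZl dotpZr mulrA -expr2 sqrtrM ?sqr_ge0// sqrtr_sqr.
Qed.

(** Cauchy-Schwarz, from the square of (v.v) u - (u.v) v. *)
Lemma dotp_le u v : dotp u v <= enorm u * enorm v.
Proof.
apply: le_trans (ler_norm _) _.
rewrite -ler_sqr ?nnegrE ?mulr_ge0 ?enorm_ge0// real_normK ?num_real//.
rewrite exprMn !enorm_sqr.
have [/dotp_eq0 ->|v0] := eqVneq (dotp v v) 0.
  by rewrite dotpC !dotp0l expr0n mulr0.
have v_gt0 : 0 < dotp v v by rewrite lt_neqAle eq_sym v0 dotp_ge0.
have := dotp_ge0 (dotp v v *: u - dotp u v *: v).
rewrite !(dotpBl, dotpBr, dotpZl, dotpZr) (dotpC v u).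
rewrite (_ : _ - _ = dotp v v * (dotp u u * dotp v v - dotp u v ^+ 2)); last ring.
by rewrite pmulr_rge0// subr_ge0.
Qed.

Lemma enormD u v : enorm (u + v) <= enorm u + enorm v.
Proof.
rewrite -ler_sqr ?nnegrE ?addr_ge0 ?enorm_ge0//.
rewrite sqrrD !enorm_sqr dotpDl !dotpDr (dotpC v u).
by have := dotp_le u v; lra.
Qed.

Lemma enormB u v : enorm (u - v) <= enorm u + enorm v.
Proof. by rewrite -(enormN v) enormD. Qed.

Lemma enorm_sum (I : Type) (r : seq I) (f : I -> 'cV[R]_d) :
  enorm (\sum_(i <- r) f i) <= \sum_(i <- r) enorm (f i).
Proof.
elim: r => [|i r IH]; first by rewrite !big_nil enorm0.
by rewrite !big_cons (le_trans (enormD _ _))// lerD2l.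
Qed.

Lemma coord_le_enorm u i : `|u i 0| <= enorm u.
Proof.
rewrite -ler_sqr ?nnegrE ?enorm_ge0// real_normK ?num_real// enorm_sqr.
rewrite /dotp (bigD1 i)//= -expr2 lerDl.
by apply: sumr_ge0 => j _; rewrite -expr2 sqr_ge0.
Qed.

Lemma enorm_le_sum_coord u : enorm u <= \sum_i `|u i 0|.
Proof.
rewrite [X in enorm X](_ : u = \sum_i u i 0 *: delta_mx i 0); last first.
  by rewrite [LHS]matrix_sum_delta; apply: eq_bigr => i _; rewrite big_ord1.
apply: le_trans (enorm_sum _ _) _; apply: ler_sum => i _.
rewrite enormZ -[leRHS]mulr1 ler_wpM2l//.
rewrite /enorm /dotp (bigD1 i)//= !mxE !eqxx mulr1 big1 ?addr0 ?sqrtr1//.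
by move=> j /negbTE ji; rewrite !mxE ji mulr0.
Qed.

Lemma outer_mulmx (u v w : 'cV[R]_d) : u *m v^T *m w = dotp v w *: u.
Proof.
rewrite -mulmxA; apply/colP => i; rewrite !mxE big_ord1 !mxE mulrC.
by congr (_ * _); apply: eq_bigr => j _; rewrite !mxE.
Qed.

(** On the unit ball, the norm of A *m x is below the sum of the absolute entries
    of A; the supremum is thus an upper bound, and the case of a general vector
    follows by scaling. *)
Lemma specnorm_le A u : enorm (A *m u) <= specnorm A * enorm u.
Proof.
have [u0|u0] := eqVneq (enorm u) 0.
  by rewrite (enorm_eq0 u0) mulmx0 enorm0 mulr0.
have u_gt0 : 0 < enorm u by rewrite lt_neqAle eq_sym u0 enorm_ge0.
rewrite -ler_pdivrMr//.
have -> : enorm (A *m u) / enorm u = enorm (A *m ((enorm u)^-1 *: u)).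
  by rewrite -scalemxAr enormZ ger0_norm ?invr_ge0 ?enorm_ge0// mulrC.
apply: ub_le_sup; last first.
  exists ((enorm u)^-1 *: u) => //=.
  by rewrite enormZ ger0_norm ?invr_ge0 ?enorm_ge0// mulVf.
exists (\sum_i \sum_j `|A i j|) => _ [x /= x1 <-].
apply: le_trans (enorm_le_sum_coord _) _.
apply: ler_sum => i _; rewrite mxE (le_trans (ler_norm_sum _ _ _))//.
apply: ler_sum => j _; rewrite normrM -[leRHS]mulr1 ler_wpM2l//.
exact: le_trans (coord_le_enorm _ _) x1.
Qed.

Lemma specnorm_ge0 A : 0 <= specnorm A.
Proof.
rewrite /specnorm; set S := (X in sup X).
have S0 : S 0 by exists 0 => //=; rewrite ?mulmx0 enorm0.
have [hS|hS] := pselect (has_sup S); first by apply: ub_le_sup => //; case: hS.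
by rewrite sup_out.
Qed.

End euclidean_norm.

(** * Gradients and Hessians along segments *)

Section calculus.
Context {R : realType} {d : nat}.
Implicit Types (u v x y : 'cV[R]_d) (K : set 'cV[R]_d) (f : 'cV[R]_d -> R).

Lemma is_derive_mulr_cst (h : R -> R) (s dh c : R) :
  is_derive s 1 h dh -> is_derive s 1 (fun t => h t * c) (dh * c).
Proof.
move=> hs; have := is_deriveZ c hs.
rewrite (_ : c \*: h = fun t => h t * c); last first.
  by apply/funext => t; rewrite /= mulrC.
by rewrite -[c *: dh]/(c * dh) mulrC.
Qed.

Lemma derive_grad f x u : differentiable f x -> 'D_u f x = dotp (grad f x) u.
Proof.
move=> df; rewrite deriveE// {1}[u]matrix_sum_delta linear_sum/= /dotp.
apply: eq_bigr => i _; rewrite big_ord1 linearZ/= mxE deriveE//.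
by rewrite mulrC.
Qed.

Lemma derive_hess f x u i : differentiable (grad f) x ->
  'D_u (fun y => grad f y i 0) x = (hess f x *m u) i 0.
Proof.
move=> df; have dfi : differentiable (fun y => grad f y i 0) x.
  apply: (@differentiable_comp _ _ _ _ (grad f) (fun M : 'cV[R]_d => M i 0)) => //.
  exact: differentiable_coord.
rewrite derive_grad// !mxE; apply: eq_bigr => j _; by rewrite !mxE.
Qed.

Lemma is_derive_line f y u (s : R) : differentiable f (y + s *: u) ->
  is_derive s 1 (fun s : R => f (y + s *: u)) ('D_u f (y + s *: u)).
Proof.
move=> df; have duf : derivable f (y + s *: u) u by exact: diff_derivable.
have E : (fun h : R => h^-1 *: (f (y + (h *: (1 : R) + s) *: u) - f (y + s *: u))) =
    (fun h : R => h^-1 *: (f (h *: u + (y + s *: u)) - f (y + s *: u))).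
  apply/funext => h; congr (_ *: (f _ - _)).
  by rewrite scalerDl -[h *: 1]/(h * 1) mulr1 addrCA.
apply: DeriveDef; first by rewrite /derivable /= E; exact: duf.
by rewrite /derive /= E.
Qed.

Lemma continuous_line y u : continuous (fun s : R => y + s *: u).
Proof. by move=> s; apply: cvgD; [exact: cvg_cst|exact: scalel_continuous]. Qed.

Lemma segmentE x y (s : R) : s *: x + (1 - s) *: y = y + s *: (x - y).
Proof. by rewrite scalerBl scale1r scalerBr addrCA. Qed.

Lemma convex_segment K x y (s : R) : convex_set K -> K x -> K y ->
  0 <= s <= 1 -> K (s *: x + (1 - s) *: y).
Proof.
move=> cK Kx Ky s01.
have := cK x y (Itv01 (andP s01).1 (andP s01).2) (mem_set Kx) (mem_set Ky).
by rewrite inE.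
Qed.

Lemma convex_line K x y (s : R) : convex_set K -> K x -> K y ->
  0 <= s <= 1 -> K (y + s *: (x - y)).
Proof. by move=> *; rewrite -segmentE; exact: convex_segment. Qed.

Section smooth.
Variables (K : set 'cV[R]_d) (f : 'cV[R]_d -> R) (M : R).
Hypotheses (cK : convex_set K) (f2 : twice_cont_diff f).
Hypothesis hessM : forall x, K x -> forall u, enorm (hess f x *m u) <= M * enorm u.
Hypothesis M0 : 0 <= M.

Lemma is_derive_dotp_grad w y u (s : R) :
  is_derive s 1 (fun s : R => dotp (grad f (y + s *: u)) w)
    (dotp (hess f (y + s *: u) *m u) w).
Proof.
case: f2 => _ dg _; rewrite /dotp.
rewrite [X in is_derive _ _ X _](_ : _ =
  \sum_i ((fun s : R => grad f (y + s *: u) i 0 * w i 0))); last first.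
  by apply/funext => t; rewrite fct_sumE.
apply: is_derive_sum => i.
apply: is_derive_mulr_cst; rewrite -(derive_hess u i (dg _)).
apply: (@is_derive_line (fun x => grad f x i 0)).
apply: (@differentiable_comp _ _ _ _ (grad f) (fun M : 'cV[R]_d => M i 0)) => //.
exact: differentiable_coord.
Qed.

(** The mean value theorem is applied to the component of the gradient along
    its own increment. *)
Lemma grad_lipschitz x y : K x -> K y ->
  enorm (grad f x - grad f y) <= M * enorm (x - y).
Proof.
move=> Kx Ky; set w := grad f x - grad f y; set u := x - y.
have [||c c01] := @MVT _ (fun s : R => dotp (grad f (y + s *: u)) w)
  (fun s => dotp (hess f (y + s *: u) *m u) w) 0 1 ltr01.
- by move=> s _; exact: is_derive_dotp_grad.
- apply: derivable_within_continuous => s _.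
  by have [] := is_derive_dotp_grad w y u s.
have yu : y + u = x by rewrite addrC subrK.
rewrite scale1r scale0r addr0 yu -dotpBl -/w subr0 mulr1 => E.
have [w0|w0] := eqVneq (enorm w) 0; first by rewrite w0 mulr_ge0 ?enorm_ge0.
rewrite -(@ler_pM2r _ (enorm w)); last by rewrite lt_neqAle eq_sym w0 enorm_ge0.
rewrite -expr2 enorm_sqr E (le_trans (dotp_le _ _))// ler_wpM2r ?enorm_ge0//.
apply: hessM; apply: convex_line => //.
by move: c01; rewrite in_itv/= => /andP[/ltW -> /ltW ->].
Qed.

(** The function s |-> f (y + s u) - s grad f(y).u - s^2 (M/2) |u|^2 is
    nonincreasing on [0, 1], its derivative being nonpositive because the gradient
    is Lipschitz. *)
Lemma descent_lemma x y : K x -> K y ->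
  f x <= f y + dotp (grad f y) (x - y) + M / 2 * enorm (x - y) ^+ 2.
Proof.
move=> Kx Ky; set u := x - y.
case: (f2) => df _ _.
pose h s := f (y + s *: u) - s * dotp (grad f y) u - s ^+ 2 * (M / 2 * enorm u ^+ 2).
have dh (s : R) : is_derive s 1 h (dotp (grad f (y + s *: u)) u
     - dotp (grad f y) u - 2 * s * (M / 2 * enorm u ^+ 2)).
  rewrite /h; apply: is_deriveB; first apply: is_deriveB.
  - by rewrite -derive_grad//; exact: is_derive_line.
  - have := @is_derive_mulr_cst id s 1 (dotp (grad f y) u) (is_derive_id s 1).
    by rewrite mul1r.
  - apply: (@is_derive_mulr_cst (fun t => t ^+ 2)).
    have := @is_deriveX _ _ id 2 s 1 1 (is_derive_id s 1).
    by rewrite /= expr1 -[_ *: _]/(_ * _) mulr1.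
have : h 1 <= h 0.
  apply: (@ler0_derive1_nincr _ h 0 1) => //.
  - move=> s; rewrite in_itv/= => /andP[s0 s1].
    rewrite derive1E derive_val -dotpBl.
    have := @grad_lipschitz (y + s *: u) y.
    rewrite addrAC subrr add0r enormZ gtr0_norm// => /(_ _ Ky) gl.
    have {}gl : enorm (grad f (y + s *: u) - grad f y) <= M * (s * enorm u).
      by apply: gl; apply: convex_line => //; apply/andP; split; exact: ltW.
    have := dotp_le (grad f (y + s *: u) - grad f y) u.
    have := ler_wpM2r (enorm_ge0 u) gl.
    by lra.
  - by apply: derivable_within_continuous => s _; have [] := dh s.
rewrite /h scale1r scale0r addr0 (_ : y + u = x); last by rewrite addrC subrK.
by rewrite expr1n expr0n/=; lra.
Qed.

End smooth.

(** The fundamental theorem of calculus, read as a mean against the uniform law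
    on the segment from y to x: a Hessian-vector product at a uniform point is an
    unbiased estimate of the increment of the gradient. *)
Lemma hess_line_mean f x y i : twice_cont_diff f ->
  has_mean lebesgue_measure (uniform_pdf 0 1)
    (fun s : R => (hess f (s *: x + (1 - s) *: y) *m (x - y)) i 0)
    ((grad f x - grad f y) i 0).
Proof.
move=> [df dg ch]; set u := x - y.
under [X in has_mean _ _ X _]eq_fun do rewrite segmentE.
pose h (s : R) := (hess f (y + s *: u) *m u) i 0.
have chs : continuous h.
  rewrite /h; under eq_fun do rewrite mxE.
  apply: continuous_big => //=; first exact: add_continuous.
  move=> j _ s; apply: cvgM; last exact: cvg_cst.
  have c1 : continuous (hess f \o (fun s : R => y + s *: u)).
    by move=> t; apply: continuous_comp; [exact: continuous_line|exact: ch].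
  exact: (continuous_comp (c1 s) (@coord_continuous _ _ _ i j _)).
have dh (s : R) : is_derive s 1 (fun s : R => grad f (y + s *: u) i 0) (h s).
  rewrite /h -(derive_hess u i (dg _)); apply: (@is_derive_line (fun y => grad f y i 0)).
  apply: (@differentiable_comp _ _ _ _ (grad f) (fun M : 'cV[R]_d => M i 0)) => //.
  exact: differentiable_coord.
have FTC : (\int[lebesgue_measure]_(s in `[0%R, 1%R]) (h s)%:E =
     ((grad f x - grad f y) i 0)%:E)%E.
  rewrite (@continuous_FTC2 _ h (fun s : R => grad f (y + s *: u) i 0))//.
  - by rewrite scale1r scale0r addr0 (_ : y + u = x) ?mxE -?EFinB ?mxE// addrC subrK.
  - exact: continuous_subspaceT.
  - have cG : continuous (fun s : R => grad f (y + s *: u) i 0).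
      move=> s; apply: differentiable_continuous; apply/derivable1_diffP.
      by have [] := dh s.
    split; [by move=> s _; have [] := dh s| |].
    + by apply: cvg_at_right_filter; exact: cG.
    + by apply: cvg_at_left_filter; exact: cG.
  - by move=> s _; rewrite derive1E derive_val.
have E : (fun s : R => (h s * uniform_pdf 0 1 s)%:E) =
    (EFin \o h) \_ `[0%R, 1%R].
  apply/funext => s; rewrite patchE /uniform_pdf /= subr0 invr1 mem_setE in_itv/=.
  by case: ifP => _; rewrite ?mulr1 ?mulr0.
have ih : lebesgue_measure.-integrable `[0%R, 1%R] (EFin \o h).
  apply: continuous_compact_integrable; first exact: segment_compact.
  exact: continuous_subspaceT.
split; rewrite /density_expectation E.
- by apply/integrable_restrict => //; rewrite setTI.
- by rewrite -integral_mkcond FTC.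
Qed.

Lemma enorm_le_diameter K x y : compact K -> K x -> K y -> enorm (x - y) <= diameter K.
Proof.
move=> cK Kx Ky; apply: ub_le_sup; last by exists (x, y).
have [M [_ HM]] := compact_bounded cK.
have {}HM w i : K w -> `|w i 0| <= M + 1.
  move=> Kw; have := HM (M + 1) _ w Kw; rewrite ltrDl => /(_ ltr01).
  apply: le_trans; rewrite [leRHS]/Num.Def.normr/= mx_normrE.
  exact: (le_bigmax _ (fun ij : 'I_d * 'I_1 => `|w ij.1 ij.2|) (i, 0)).
exists (\sum_(i < d) (2 * (M + 1))) => _ [[x' y'] [/= Kx' Ky'] <-].
apply: le_trans (enorm_le_sum_coord _) _; apply: ler_sum => i _.
rewrite !mxE (le_trans (ler_normB _ _))//.
by have := HM x' i Kx'; have := HM y' i Ky'; lra.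
Qed.

End calculus.

(** * Measurability of functions continuous in a vector variable *)

Section caratheodory.
Context {R : realType} {d : nat}.
Implicit Types (x : 'cV[R]_d).

Let grid (n : nat) (k : 'cV[int]_d) : 'cV[R]_d := \col_i ((k i 0)%:~R / n.+1%:R).
Let cell (n : nat) x : 'cV[int]_d := \col_i Num.floor (x i 0 * n.+1%:R).

Let grid_cvg x : (fun n => grid n (cell n x)) @ \oo --> x.
Proof.
apply/cvgrPdist_le => e e0; near=> n.
rewrite /Num.norm/= mx_normrE; apply: bigmax_le; first exact: ltW.
move=> [i j] _ /=; rewrite (ord1 j) !mxE.
have n0 : (0 : R) < n.+1%:R by [].
rewrite -[X in X - _](mulfK (lt0r_neq0 n0)) -mulrBl normrM normfV (gtr0_norm n0).
rewrite ler_pdivrMr//.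
have /andP[f1 f2] := floor_itv (x i 0 * n.+1%:R).
rewrite ger0_norm ?subr_ge0//.
apply: (@le_trans _ _ 1); first by apply/ltW; rewrite ltrBlDl; move: f2; rewrite intrD.
rewrite mulrC -ler_pdivrMr// mul1r.
near: n.
exists (Num.truncn e^-1) => // m /= mt.
apply/ltW; apply: lt_le_trans (truncnS_gt _) _; rewrite ler_nat; exact: leq_trans mt _.
Unshelve. all: by end_near. Qed.

(** The vector X is rounded down to the grid of mesh 1 / (n + 1). The rounded
    vector takes countably many values, on each of which only the measurability of
    one function phi x matters; the rounding is removed by letting n grow, thanks
    to the continuity of phi in its first argument. *)
Lemma caratheodory_measurable (d1 d2 : measure_display) (T : measurableType d1)
    (S : measurableType d2) (phi : 'cV[R]_d -> S -> R)
    (X : T -> 'cV[R]_d) (zeta : T -> S) :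
  (forall s, continuous (phi^~ s)) -> (forall x, measurable_fun setT (phi x)) ->
  mx_measurable_fun X -> measurable_fun setT zeta ->
  measurable_fun setT (fun w => phi (X w) (zeta w)).
Proof.
move=> cphi mphi mX mzeta.
apply: (@measurable_fun_cvg _ _ _ _ (fun n w => phi (grid n (cell n (X w))) (zeta w))).
  2: move=> w _ /=.
  2: by exact: (cvg_comp _ _ (@grid_cvg (X w)) (cphi _ _)).
move=> n _ B mB; rewrite setTI.
pose E k := [set w | cell n (X w) = k] `&` zeta @^-1` (phi (grid n k) @^-1` B).
have mE k : measurable (E k).
  apply: measurableI.
    rewrite (_ : [set w | _] = \bigcap_(i in [set: 'I_d])
       ((fun w => X w i 0) @^-1` `[(k i 0)%:~R / n.+1%:R, (k i 0 + 1)%:~R / n.+1%:R[)).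
      apply: fin_bigcap_measurable => // i _.
      by rewrite -[X in measurable X]setTI; apply: mX => //; exact: measurable_itv.
    have n0 : (0 : R) < n.+1%:R by [].
    apply/seteqP; split => [w /= <- i _ /=|w /= H].
      rewrite !mxE in_itv/= ler_pdivrMr// ltr_pdivlMr//; exact: floor_itv.
    apply/colP => i; rewrite mxE; apply: floor_def.
    by have := H i I; rewrite /= in_itv/= ler_pdivrMr// ltr_pdivlMr.
  rewrite -[X in measurable X]setTI; apply: mzeta => //.
  by rewrite -[X in measurable X]setTI; exact: mphi.
rewrite (_ : _ @^-1` _ = \bigcup_m (if unpickle m is Some k then E k else set0)).
  by apply: bigcupT_measurable => m; case: unpickle.
apply/seteqP; split => [w /= Bw|w [m _]].
  by exists (pickle (cell n (X w))) => //; rewrite pickleK.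
by case: unpickle => // k [/= <-].
Qed.

Lemma caratheodory_measurable_mx (d1 d2 : measure_display) (T : measurableType d1)
    (S : measurableType d2) m n (Phi : 'cV[R]_d -> S -> 'M[R]_(m, n))
    (X : T -> 'cV[R]_d) (zeta : T -> S) :
  (forall s, continuous (Phi^~ s)) -> (forall x, mx_measurable_fun (Phi x)) ->
  mx_measurable_fun X -> measurable_fun setT zeta ->
  mx_measurable_fun (fun w => Phi (X w) (zeta w)).
Proof.
move=> cPhi mPhi mX mzeta i j.
apply: (@caratheodory_measurable _ _ _ _ (fun x s => Phi x s i j)) => //.
  move=> s x; apply: (@continuous_comp _ _ _ (Phi^~ s) (fun M : 'M[R]_(m, n) => M i j)).
    exact: cPhi.
  exact: coord_continuous.
by move=> x; exact: mPhi.
Qed.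

End caratheodory.

Section mx_measurable.
Context {R : realType} {d0 : measure_display} {T : measurableType d0}.

Lemma mx_measurable_cst m n (A : 'M[R]_(m, n)) : mx_measurable_fun (fun _ : T => A).
Proof. by move=> i j; exact: measurable_cst. Qed.

Lemma mx_measurableD m n (X Y : T -> 'M[R]_(m, n)) :
  mx_measurable_fun X -> mx_measurable_fun Y -> mx_measurable_fun (fun w => X w + Y w).
Proof.
by move=> mX mY i j; under eq_fun do rewrite mxE; exact: measurable_funD.
Qed.

Lemma mx_measurableZ m n (c : T -> R) (X : T -> 'M[R]_(m, n)) :
  measurable_fun setT c -> mx_measurable_fun X -> mx_measurable_fun (fun w => c w *: X w).
Proof.
by move=> mc mX i j; under eq_fun do rewrite mxE; exact: measurable_funM.
Qed.

Lemma mx_measurableB m n (X Y : T -> 'M[R]_(m, n)) :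
  mx_measurable_fun X -> mx_measurable_fun Y -> mx_measurable_fun (fun w => X w - Y w).
Proof.
by move=> mX mY i j; under eq_fun do rewrite !mxE; exact: measurable_funB.
Qed.

Lemma mx_measurable_trmx m n (X : T -> 'M[R]_(m, n)) :
  mx_measurable_fun X -> mx_measurable_fun (fun w => (X w)^T).
Proof. by move=> mX i j; under eq_fun do rewrite mxE; exact: mX. Qed.

Lemma mx_measurable_mulmx m n k (X : T -> 'M[R]_(m, n)) (Y : T -> 'M[R]_(n, k)) :
  mx_measurable_fun X -> mx_measurable_fun Y -> mx_measurable_fun (fun w => X w *m Y w).
Proof.
move=> mX mY i j; under eq_fun do rewrite mxE.
by apply: measurable_sum => l; exact: measurable_funM.
Qed.

Lemma measurable_dotp d (X Y : T -> 'cV[R]_d) :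
  mx_measurable_fun X -> mx_measurable_fun Y ->
  measurable_fun setT (fun w => dotp (X w) (Y w)).
Proof.
by move=> mX mY; apply: measurable_sum => l; exact: measurable_funM.
Qed.

Lemma measurable_enorm_sqr d (X : T -> 'cV[R]_d) :
  mx_measurable_fun X -> measurable_fun setT (fun w => enorm (X w) ^+ 2).
Proof.
move=> mX; under eq_fun do rewrite enorm_sqr; exact: measurable_dotp.
Qed.

Lemma measurable_enorm d (X : T -> 'cV[R]_d) :
  mx_measurable_fun X -> measurable_fun setT (fun w => enorm (X w)).
Proof.
move=> mX; apply: (measurableT_comp (f := @Num.sqrt R)).
  by apply: continuous_measurable_fun; exact: sqrt_continuous.
exact: measurable_dotp.
Qed.

End mx_measurable.

(** * Means with respect to a density *)

Section has_mean_theory.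
Context {R : realType} {dZ : measure_display} {Z : measurableType dZ}.
Variables (mu : {measure set Z -> \bar R}) (q : Z -> R).
Implicit Types (h k : Z -> R) (m n c : R).

Lemma has_meanZ c h m : has_mean mu q h m -> has_mean mu q (fun z => c * h z) (c * m).
Proof.
move=> [ih hm]; rewrite /has_mean /density_expectation.
have E : (fun z => (c * h z * q z)%:E) = (fun z => c%:E * (h z * q z)%:E)%E.
  by apply/funext => z; rewrite -EFinM mulrA.
split; first by rewrite E; exact: integrableZl.
by rewrite E integralZl// EFinM; congr (_ * _)%E.
Qed.

Lemma has_meanD h k m n : has_mean mu q h m -> has_mean mu q k n ->
  has_mean mu q (fun z => h z + k z) (m + n).
Proof.
move=> [ih hm] [ik kn]; rewrite /has_mean /density_expectation.
have E : (fun z => ((h z + k z) * q z)%:E) =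
    (fun z => (h z * q z)%:E + (k z * q z)%:E)%E.
  by apply/funext => z; rewrite -EFinD mulrDl.
split; first by rewrite E; exact: integrableD.
by rewrite E integralD// EFinD; congr (_ + _)%E.
Qed.

Lemma has_meanB h k m n : has_mean mu q h m -> has_mean mu q k n ->
  has_mean mu q (fun z => h z - k z) (m - n).
Proof.
move=> ih /(has_meanZ (-1)) ik; have := has_meanD ih ik; rewrite mulN1r.
by under [X in has_mean _ _ X _ -> _]eq_fun do rewrite mulN1r.
Qed.

Lemma has_mean0 : has_mean mu q (fun=> 0) 0.
Proof.
rewrite /has_mean /density_expectation; under eq_fun do rewrite mul0r.
by split; [exact: integrable0|rewrite integral0].
Qed.

Lemma has_mean_sum (I : eqType) (r : seq I) (h : I -> Z -> R) (m : I -> R) :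
  (forall i, i \in r -> has_mean mu q (h i) (m i)) ->
  has_mean mu q (fun z => \sum_(i <- r) h i z) (\sum_(i <- r) m i).
Proof.
elim: r => [_|i r IH H].
  by rewrite big_nil; under [X in has_mean _ _ X _]eq_fun do rewrite big_nil;
     exact: has_mean0.
rewrite big_cons; under [X in has_mean _ _ X _]eq_fun do rewrite big_cons.
apply: has_meanD; first by apply: H; rewrite mem_head.
by apply: IH => k kr; apply: H; rewrite in_cons kr orbT.
Qed.

Lemma has_mean_dotpl d (h : Z -> 'cV[R]_d) (m w : 'cV[R]_d) :
  has_mean_mx mu q h m -> has_mean mu q (fun z => dotp w (h z)) (dotp w m).
Proof. by move=> hm; apply: has_mean_sum => i _; exact: has_meanZ. Qed.

Lemma has_mean_mulmx d l (h : Z -> 'M[R]_(d, l)) (m : 'M[R]_(d, l)) (u : 'cV[R]_l) :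
  has_mean_mx mu q h m -> has_mean_mx mu q (fun z => h z *m u) (m *m u).
Proof.
move=> hm i j; rewrite mxE; under [X in has_mean _ _ X _]eq_fun do rewrite mxE.
apply: has_mean_sum => r _; rewrite mulrC.
by under [X in has_mean _ _ X _]eq_fun do rewrite mulrC; exact: has_meanZ.
Qed.

Lemma has_mean_expectation h m :
  has_mean mu q h m -> density_expectation mu q h = m%:E.
Proof. by case. Qed.

Hypothesis q0 : forall z, 0 <= q z.

Lemma has_mean_le h k m n : has_mean mu q h m -> has_mean mu q k n ->
  (forall z, h z <= k z) -> m <= n.
Proof.
move=> [ih hm] [ik kn] hk; rewrite -lee_fin -hm -kn.
by apply: le_integral => // z _; rewrite lee_fin ler_wpM2r.
Qed.

Lemma has_mean_of_le h c : measurable_fun setT h -> measurable_fun setT q ->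
  (forall z, 0 <= h z) -> (density_expectation mu q h <= c%:E)%E ->
  exists2 m, has_mean mu q h m & m <= c.
Proof.
move=> mh mq h0 hc.
have f0 z : (0 <= (h z * q z)%:E)%E by rewrite lee_fin mulr_ge0.
have I0 : (0 <= density_expectation mu q h)%E by exact: integral_ge0.
have E : density_expectation mu q h = (fine (density_expectation mu q h))%:E.
  by rewrite fineK// ge0_fin_numE// (le_lt_trans hc)// ltry.
exists (fine (density_expectation mu q h)); last by rewrite -lee_fin -E.
split=> //; apply/integrableP; split.
  by apply/measurable_EFinP; exact: measurable_funM.
under eq_integral => z _ do rewrite gee0_abs//.
by rewrite (le_lt_trans hc)// ltry.
Qed.

Lemma density_expectation_le h k m : measurable_fun setT h -> measurable_fun setT q ->
  (forall z, 0 <= h z) -> (forall z, h z <= k z) -> has_mean mu q k m ->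
  (density_expectation mu q h <= m%:E)%E.
Proof.
move=> mh mq h0 hk [ik <-]; apply: ge0_le_integral => //.
- by move=> z _; rewrite lee_fin mulr_ge0.
- by apply/measurable_EFinP; exact: measurable_funM.
- exact: measurable_int ik.
- by move=> z _; rewrite lee_fin ler_wpM2r.
Qed.

Lemma has_mean_cst c : density_law mu q setT = 1%E -> measurable_fun setT q ->
  has_mean mu q (fun=> c) c.
Proof.
move=> q1 mq; rewrite -{2}(mulr1 c).
have -> : (fun=> c) = (fun z : Z => c * 1) by apply/funext => z; rewrite mulr1.
apply: has_meanZ; rewrite /has_mean /density_expectation.
under eq_fun do rewrite mul1r.
split; last by [].
apply/integrableP; split; first exact/measurable_EFinP.
under eq_integral => z _ do rewrite gee0_abs ?lee_fin//.
by move: q1; rewrite /density_law => ->; rewrite ltry.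
Qed.

(** The pointwise inequality 2 m.h - |m|^2 <= |h|^2 is integrated, m being the mean
    of h: a mean is no longer than the root mean square. *)
Lemma enorm_mean_sqr_le d (h : Z -> 'cV[R]_d) (m : 'cV[R]_d) (c : R) :
  density_law mu q setT = 1%E -> measurable_fun setT q ->
  has_mean_mx mu q h m -> has_mean mu q (fun z => enorm (h z) ^+ 2) c ->
  enorm m ^+ 2 <= c.
Proof.
move=> q1 mq hm hc.
have H1 : has_mean mu q (fun z => 2 * dotp m (h z) - enorm m ^+ 2) (enorm m ^+ 2).
  rewrite [X in has_mean _ _ _ X](_ : _ = 2 * dotp m m - enorm m ^+ 2).
    by apply: has_meanB; [apply/has_meanZ/has_mean_dotpl|exact: has_mean_cst].
  by rewrite enorm_sqr; ring.
apply: (has_mean_le H1 hc) => z.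
have := sqr_ge0 (enorm (h z - m)); rewrite !enorm_sqr dotpBl !dotpBr (dotpC (h z)).
by lra.
Qed.

End has_mean_theory.

(** * Conditional laws given by densities *)

Section density_measure.
Local Open Scope ereal_scope.
Context {R : realType} {d0 : measure_display} {Z : measurableType d0}.
Variables (mu : {measure set Z -> \bar R}) (q : Z -> R).
Hypothesis q0 : forall z, (0 <= q z)%R.
Hypothesis mq : measurable_fun setT q.

(** The two hypotheses are arguments so that the measure structure can be attached
    to the function itself. *)
Definition density_measure of (forall z, (0 <= q z)%R) & measurable_fun setT q :=
  density_law mu q.

Local Notation nu := (density_measure q0 mq).

Let nu0 : nu set0 = 0.
Proof. by rewrite /density_measure /density_law integral_set0. Qed.

Let nu_ge0 A : 0 <= nu A.
Proof. by apply: integral_ge0 => z _; rewrite lee_fin. Qed.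

Let nu_sigma_additive : semi_sigma_additive nu.
Proof.
move=> F mF tF mUF; rewrite /density_measure /density_law; apply: cvg_toP.
  apply: ereal_nondecreasing_is_cvgn => m n mn.
  apply: lee_sum_nneg_natr => // k _ _.
  by apply: integral_ge0 => z _; rewrite lee_fin.
rewrite ge0_integral_bigcup//=.
- exact/measurable_EFinP/measurable_funTS.
- by move=> z _; rewrite lee_fin.
Qed.

HB.instance Definition _ := isMeasure.Build _ _ _ nu nu0 nu_ge0 nu_sigma_additive.

End density_measure.

Section integral_density.
Local Open Scope ereal_scope.
Context {R : realType} {d0 : measure_display} {Z : measurableType d0}.
Variables (mu nu : {measure set Z -> \bar R}) (q : Z -> R).
Hypothesis q0 : forall z, (0 <= q z)%R.
Hypothesis mq : measurable_fun setT q.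
Hypothesis nuE : forall A, measurable A -> nu A = density_law mu q A.

Import HBNNSimple.

Let mqE : measurable_fun setT (EFin \o q).
Proof. exact/measurable_EFinP. Qed.

Let integral_density_nnsfun (f : {nnsfun Z >-> R}) :
  \int[nu]_z (f z)%:E = \int[mu]_z ((f z)%:E * (q z)%:E).
Proof.
under [LHS]eq_integral do rewrite fimfunE -fsumEFin//.
rewrite [LHS]ge0_integral_fsum//; last 2 first.
  - by move=> r; exact/measurable_EFinP/measurableT_comp.
  - by move=> n x _; rewrite EFinM nnfun_muleindic_ge0.
under [RHS]eq_integral.
  move=> x xD; rewrite fimfunE -fsumEFin// ge0_mule_fsuml; last first.
    by move=> r; rewrite EFinM nnfun_muleindic_ge0.
  over.
rewrite [RHS]ge0_integral_fsum//; last 2 first.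
  - move=> r; apply: emeasurable_funM => //.
    by apply/measurable_EFinP; apply/measurableT_comp.
  - by move=> n x _; rewrite mule_ge0 ?nnfun_muleindic_ge0// lee_fin.
apply: eq_fsbigr => r _.
rewrite integralZl_indic_nnsfun// integral_indic// setIT nuE// /density_law.
have [r0|r0] := leP 0%R r; last first.
  rewrite preimage_nnfun0// integral_set0 mule0 integral0_eq// => x _.
  by rewrite indic0 mulr0 mul0e.
rewrite -ge0_integralZl//=.
- rewrite integral_mkcond; apply: eq_integral => x _; rewrite patchE.
  by rewrite indicE; case: ifPn => _; rewrite ?mulr1// mulr0 mul0e.
- exact: measurable_funTS.
- by move=> x _; rewrite lee_fin.
Qed.

(** The formula holds for indicators by assumption, hence for simple functions,
    and in general by monotone convergence. *)
Lemma integral_density (f : Z -> \bar R) : measurable_fun setT f ->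
  (forall z, 0 <= f z) -> \int[nu]_z f z = \int[mu]_z (f z * (q z)%:E).
Proof.
move=> mf f0; pose f_ := nnsfun_approx measurableT mf.
transitivity (lim (\int[nu]_x (f_ n x)%:E @[n --> \oo])).
  rewrite -monotone_convergence//=.
  - apply: eq_integral => ? /[!inE] xD; apply/esym/cvg_lim => //=.
    exact: cvg_nnsfun_approx.
  - by move=> n; exact/measurable_EFinP/measurable_funTS.
  - by move=> n ? _; rewrite lee_fin.
  - by move=> ? _ ? ? mn; rewrite lee_fin; exact/lefP/nd_nnsfun_approx.
transitivity (lim (\int[mu]_x ((f_ n x)%:E * (q x)%:E) @[n --> \oo])).
  by under eq_fun do rewrite integral_density_nnsfun.
rewrite -monotone_convergence//=.
- apply: eq_integral => z /[!inE] xD; apply/cvg_lim => //=.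
  apply: cvgeZr => //; exact: cvg_nnsfun_approx.
- by move=> n; apply: emeasurable_funM => //; exact/measurable_EFinP/measurable_funTS.
- by move=> n ? _; rewrite mule_ge0// lee_fin.
- move=> z _ m n mn; rewrite lee_wpmul2r ?lee_fin//.
  exact/lefP/nd_nnsfun_approx.
Qed.

End integral_density.

Section disintegration.
Local Open Scope ereal_scope.
Context {R : realType} {dO dS dZ : measure_display}.
Context {Omega : measurableType dO} {S : measurableType dS} {Z : measurableType dZ}.
Variables (P : probability Omega R) (mu : {sigma_finite_measure set Z -> \bar R}).
Variables (X : Omega -> S) (zeta : Omega -> Z) (q : S -> Z -> R).
Hypotheses (mX : measurable_fun setT X) (mzeta : measurable_fun setT zeta).
Hypothesis q0 : forall s z, (0 <= q s z)%R.
Hypothesis mq : measurable_fun setT (fun sz : S * Z => q sz.1 sz.2).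
Hypothesis condZ : forall E B, measurable E -> measurable B ->
  P (X @^-1` E `&` zeta @^-1` B) = \int[P]_(w in X @^-1` E) density_law mu (q (X w)) B.

Let q' (sz : S * Z) := q sz.1 sz.2.

Let mqE' : measurable_fun setT (fun sz => (q' sz)%:E).
Proof. exact/measurable_EFinP. Qed.

(** The hypothesis condZ says that q (X w) is the density of the conditional law of
    zeta given X. The joint law of X and zeta then has the density q with respect to
    the product of the law of X and mu: the two measures agree on rectangles. *)
Lemma disintegration (f : S * Z -> \bar R) : measurable_fun setT f ->
  (forall sz, 0 <= f sz) ->
  \int[P]_w f (X w, zeta w) =
  \int[P]_w \int[mu]_z (f (X w, z) * (q (X w) z)%:E).
Proof.
move=> mf f0.
pose Xm : {mfun Omega >-> S} := HB.pack X (isMeasurableFun.Build _ _ _ _ X mX).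
have mXZ : measurable_fun setT (fun w => (X w, zeta w)) by exact: measurable_fun_pair.
pose XZm : {mfun Omega >-> (S * Z)%type} :=
  HB.pack (fun w => (X w, zeta w)) (isMeasurableFun.Build _ _ _ _ _ mXZ).
pose PX := distribution P Xm.
pose nu := distribution P XZm.
have q'0 sz : (0 <= q' sz)%R by exact: q0.
have nuE C : measurable C -> nu C = density_law (PX \x mu) q' C.
  pose m2 := density_measure (PX \x mu) q'0 mq.
  pose G := [set A `*` B | A in @measurable _ S & B in @measurable _ Z].
  apply: (@measure_unique _ _ _ G (fun=> setT) _ _ _ _ nu m2) => //.
  - by rewrite measurable_prod_measurableType.
  - move=> _ _ [A1 mA1 [B1 mB1 <-]] [A2 mA2 [B2 mB2 <-]].
    exists (A1 `&` A2); first exact: measurableI.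
    by exists (B1 `&` B2); [exact: measurableI|rewrite setXI].
  - by move=> _; exists setT => //; exists setT => //; rewrite setXTT.
  - by rewrite bigcup_const.
  - move=> _ [A mA [B mB <-]].
    transitivity (P (X @^-1` A `&` zeta @^-1` B)); first by [].
    rewrite condZ// /m2 /density_measure /density_law [RHS]integral_mkcond.
    rewrite fubini_tonelli1; first last.
    - by move=> sz; apply: erestrict_ge0 => ? _; rewrite lee_fin.
    - by apply/(measurable_restrictT _ _).1; [exact: measurableX|exact: measurable_funTS].
    rewrite /fubini_F ge0_integral_distribution; first last.
    - by move=> s; apply: integral_ge0 => z _; apply: erestrict_ge0 => ? _; rewrite lee_fin.
    - apply: (measurable_fun_fubini_tonelli_F ((fun sz => (q' sz)%:E) \_ (A `*` B))).
        by apply/(measurable_restrictT _ _).1; [exact: measurableX|exact: measurable_funTS].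
      by move=> sz; apply: erestrict_ge0 => ? _; rewrite lee_fin.
    rewrite integral_mkcond; apply: eq_integral => w _ /=.
    rewrite patchE; case: ifPn => [|]; rewrite ?inE ?notin_setE/= => XA.
      rewrite [LHS]integral_mkcond; apply: eq_integral => z _.
      by rewrite !patchE in_setX/= (mem_set XA).
    rewrite integral0_eq// => z _; rewrite patchE in_setX/=.
    by rewrite (negbTE (introN idP (fun h => XA (set_mem h)))).
  - by move=> _; rewrite (le_lt_trans (probability_le1 _ _))// ltry.
transitivity (\int[nu]_sz f sz); first by rewrite ge0_integral_distribution.
rewrite (integral_density q'0 mq nuE)//.
rewrite fubini_tonelli1; first last.
- by move=> sz; rewrite mule_ge0// lee_fin.
- exact: emeasurable_funM.
rewrite /fubini_F ge0_integral_distribution//.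
- by apply: (measurable_fun_fubini_tonelli_F (fun sz => f sz * (q' sz)%:E));
    [exact: emeasurable_funM|move=> sz; rewrite mule_ge0// lee_fin].
- by move=> s; apply: integral_ge0 => z _; rewrite mule_ge0// lee_fin.
Qed.

Lemma measurable_density_integral (f : S * Z -> \bar R) : measurable_fun setT f ->
  (forall sz, 0 <= f sz) ->
  measurable_fun setT (fun s => \int[mu]_z (f (s, z) * (q s z)%:E)).
Proof.
move=> mf f0.
apply: (measurable_fun_fubini_tonelli_F (fun sz => f sz * (q' sz)%:E)).
  exact: emeasurable_funM.
by move=> sz; rewrite mule_ge0// lee_fin; exact: q0.
Qed.

End disintegration.

(** * The sequence n^(-1/3) *)

Section rates.
Context {R : realType}.
Implicit Types (tau sigma nu kappa : R).

Lemma ler_sqr_of_cube (x y : R) : 0 <= x -> 0 <= y -> x ^+ 3 <= y ^+ 3 -> x ^+ 2 <= y ^+ 2.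
Proof.
move=> x0 y0; rewrite ler_pXn2r// => xy; rewrite ler_pXn2r//.
Qed.

(** The convexity inequality s^(-2/3) - (2/3) s^(-5/3) <= (s + 1)^(-2/3), where
    tau = s^(-1/3) and sigma = (s + 1)^(-1/3). *)
Lemma inv_cbrt_sqr_succ tau sigma : 0 < tau <= 1 -> 0 < sigma ->
  sigma ^+ 3 * (1 + tau ^+ 3) = tau ^+ 3 ->
  tau ^+ 2 - 2 / 3 * tau ^+ 5 <= sigma ^+ 2.
Proof.
move=> /andP[t0 t1] s0 E; set X := tau ^+ 3 in E *.
have X0 : 0 < X by rewrite exprn_gt0.
have X1 : X <= 1 by rewrite exprn_ile1// ltW.
have -> : tau ^+ 2 - 2 / 3 * tau ^+ 5 = tau ^+ 2 * (1 - 2 / 3 * X) by rewrite /X; ring.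
have q0 : 0 <= tau ^+ 2 * (1 - 2 / 3 * X) by rewrite mulr_ge0 ?sqr_ge0//; lra.
rewrite -(@ler_pXn2r _ 3)// ?nnegrE ?sqr_ge0//.
have -> : (tau ^+ 2 * (1 - 2 / 3 * X)) ^+ 3 = X ^+ 2 * (1 - 2 / 3 * X) ^+ 3.
  by rewrite /X; ring.
have -> : (sigma ^+ 2) ^+ 3 = (sigma ^+ 3) ^+ 2 by ring.
have X10 : 0 < (1 + X) ^+ 2 by rewrite exprn_gt0// addr_gt0.
rewrite -(ler_pM2r X10) -[leRHS]exprMn E -(mulrA (X ^+ 2)) -[leRHS]mulr1 ler_wpM2l ?sqr_ge0//.
rewrite -subr_ge0.
have -> : 1 - (1 - 2 / 3 * X) ^+ 3 * (1 + X) ^+ 2 =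
  X ^+ 2 * (5 / 3 - 10 / 27 * X - 20 / 27 * X ^+ 2 + 8 / 27 * X ^+ 3) by field.
rewrite mulr_ge0 ?sqr_ge0//.
have X2 : X ^+ 2 <= 1 by rewrite exprn_ile1// ltW.
have X3 : 0 <= X ^+ 3 by rewrite exprn_ge0// ltW.
by lra.
Qed.

Lemma cbrt_half_bounds nu : 0 < nu -> nu ^+ 3 = 2^-1 -> 4 / 9 <= nu ^+ 2 /\ nu < 1.
Proof.
move=> n0 n3; split.
  have -> : 4 / 9 = (2 / 3 : R) ^+ 2 by field.
  by apply: ler_sqr_of_cube; [lra|lra|rewrite n3; lra].
rewrite -(@ltr_pXn2r _ 3)// ?nnegrE// ?ltW//; rewrite n3 expr1n; lra.
Qed.

(** The rate C t^(-2/3) is preserved by the recursion of the mean squared error.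
    Here tau = s^(-1/3) and sigma = (s + 1)^(-1/3), so that tau^2 is both the
    averaging weight and a bound on the step size; q comes from the noise and m from
    the bias. The lower bounds on C give q^2 <= (kappa / 2) C and, with c the fourth
    root of C, m c^2 <= c^3 <= (kappa / 2) C. What remains is
    tau^2 - (2/3 + nu^2) tau^4 + tau^6 <= tau^2 - (2/3) tau^5, which holds as soon as
    tau <= nu = 2^(-1/3); for s = 1 the past is forgotten, since the weight is 1. *)
Lemma error_rate_step (C q m nu tau sigma : R) :
  let kappa := 4 / 3 - nu ^+ 2 in
  0 < nu -> nu ^+ 3 = 2^-1 -> 0 < tau <= 1 -> (tau < 1 -> tau <= nu) -> 0 < sigma ->
  sigma ^+ 3 * (1 + tau ^+ 3) = tau ^+ 3 -> 0 <= m ->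
  2 * q ^+ 2 / kappa <= C -> (2 / kappa) ^+ 4 <= C -> m ^+ 4 <= C ->
  (1 - tau ^+ 2) ^+ 2 * (C * tau ^+ 2)
  + (1 - tau ^+ 2) * tau ^+ 2 * (m * tau ^+ 2) * (Num.sqrt C * tau)
  + (tau ^+ 2) ^+ 2 * q ^+ 2 <= C * sigma ^+ 2.
Proof.
move=> kappa n0 n3 t01 tn s0 E m0 hq hk hm.
have [t0 t1] := andP t01.
have [n2 n1] := cbrt_half_bounds n0 n3.
have n2' : nu ^+ 2 < 1 by rewrite expr_lt1// ltW.
have k0 : 0 < kappa by rewrite /kappa; lra.
have C0 : 0 <= C by apply: le_trans hk; rewrite exprn_ge0// divr_ge0// ltW.
pose c := Num.sqrt (Num.sqrt C).
have c0 : 0 <= c by exact: sqrtr_ge0.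
have c2 : Num.sqrt C = c ^+ 2 by rewrite sqr_sqrtr// sqrtr_ge0.
have c4 : C = c ^+ 4 by rewrite (exprM _ 2 2) -c2 sqr_sqrtr.
have mc : m <= c by move: hm; rewrite c4 ler_pXn2r.
have kc : 2 <= kappa * c.
  rewrite mulrC -ler_pdivrMr//.
  by move: hk; rewrite c4 ler_pXn2r// nnegrE divr_ge0// ltW.
have hq' : q ^+ 2 <= kappa / 2 * C.
  by move: hq; rewrite ler_pdivrMr//; lra.
have al0 : 0 <= 1 - tau ^+ 2 by rewrite subr_ge0 expr_le1// ltW.
have bias : (1 - tau ^+ 2) * tau ^+ 2 * (m * tau ^+ 2) * (Num.sqrt C * tau) <=
    (1 - tau ^+ 2) * (kappa / 2 * C) * tau ^+ 5.
  have -> : (1 - tau ^+ 2) * tau ^+ 2 * (m * tau ^+ 2) * (Num.sqrt C * tau) =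
    (1 - tau ^+ 2) * (m * c ^+ 2) * tau ^+ 5 by rewrite c2; ring.
  apply: ler_wpM2r; first by rewrite exprn_ge0// ltW.
  apply: ler_wpM2l => //.
  apply: (@le_trans _ _ (c ^+ 3)).
    by rewrite [c ^+ 3]exprS ler_wpM2r// sqr_ge0.
  rewrite c4.
  have -> : kappa / 2 * c ^+ 4 = kappa * c / 2 * c ^+ 3 by field.
  rewrite ler_peMl ?exprn_ge0//; lra.
have noise : (tau ^+ 2) ^+ 2 * q ^+ 2 <= tau ^+ 4 * (kappa / 2 * C).
  have -> : (tau ^+ 2) ^+ 2 = tau ^+ 4 by ring.
  by rewrite ler_wpM2l// exprn_ge0// ltW.
apply: (@le_trans _ _ (C * ((1 - tau ^+ 2) ^+ 2 * tau ^+ 2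
    + kappa / 2 * (tau ^+ 4 + (1 - tau ^+ 2) * tau ^+ 5)))); first by lra.
rewrite ler_wpM2l//.
have [t1'|t1'] := eqVneq tau 1.
  rewrite t1' !expr1n in E *; have s3 : sigma ^+ 3 = 2^-1 by lra.
  have [s2 _] := cbrt_half_bounds s0 s3.
  by rewrite /kappa; lra.
have tn' : tau <= nu by apply: tn; rewrite lt_neqAle t1'.
apply: le_trans (inv_cbrt_sqr_succ t01 s0 E).
have t4 : 0 <= tau ^+ 4 by rewrite exprn_ge0// ltW.
have t54 : (1 - tau ^+ 2) * tau ^+ 5 <= tau ^+ 4.
  rewrite (exprSr tau 4) mulrCA -[leRHS]mulr1 ler_wpM2l//.
  apply: mulr_ile1 => //; [exact: ltW|by rewrite gerBl sqr_ge0].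
have tn2 : tau ^+ 2 <= nu ^+ 2 by rewrite ler_pXn2r// nnegrE ltW.
have k2 : 0 <= kappa / 2 by rewrite divr_ge0// ltW.
have := ler_wpM2l k2 t54.
have : 0 <= tau ^+ 4 * (2 / 3 + nu ^+ 2 - 2 / 3 * tau - tau ^+ 2).
  by rewrite mulr_ge0//; lra.
by rewrite /kappa; lra.
Qed.

Definition inv_cbrt (n : nat) : R := n%:R `^ (- (1 / 3)).

Lemma inv_cbrt_gt0 n : (0 < n)%N -> 0 < inv_cbrt n.
Proof. by move=> n0; rewrite powR_gt0// ltr0n. Qed.

Lemma inv_cbrt1 : inv_cbrt 1 = 1.
Proof. by rewrite /inv_cbrt powR1. Qed.

Lemma inv_cbrt_cube n : (0 < n)%N -> inv_cbrt n ^+ 3 = n%:R^-1.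
Proof.
move=> n0; rewrite /inv_cbrt -powR_mulrn ?powR_ge0// -powRrM.
by rewrite (_ : - (1 / 3) * 3%:R = -1 :> R); [rewrite powR_inv1|field].
Qed.

Lemma inv_cbrt_sqr n : inv_cbrt n ^+ 2 = n%:R `^ (- (2 / 3)).
Proof.
rewrite /inv_cbrt -powR_mulrn ?powR_ge0// -powRrM; congr (_ `^ _); by field.
Qed.

Lemma inv_cbrt_le m n : (0 < m <= n)%N -> inv_cbrt n <= inv_cbrt m.
Proof.
move=> /andP[m0 mn]; have n0 := leq_trans m0 mn.
rewrite -(@ler_pXn2r _ 3)// ?nnegrE ?powR_ge0// !inv_cbrt_cube//.
by rewrite lef_pV2 ?posrE ?ltr0n// ler_nat.
Qed.

Lemma inv_cbrt_succ n : (0 < n)%N ->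
  inv_cbrt n.+1 ^+ 3 * (1 + inv_cbrt n ^+ 3) = inv_cbrt n ^+ 3.
Proof.
move=> n0; rewrite !inv_cbrt_cube//.
have nR : n%:R != 0 :> R by rewrite pnatr_eq0 -lt0n.
have nS : 1 + n%:R != 0 :> R by rewrite addrC natr1 pnatr_eq0.
by rewrite -natr1 (addrC n%:R); field; rewrite nR nS.
Qed.

(** The sum is compared with the integral of t^(-1/3), that is (3/2) T^(2/3); the
    increments are compared through (a - b)^2 (a + 2 b) >= 0 where a and b are
    the cubic roots of consecutive integers. *)
Lemma sum_inv_cbrt_le n :
  \sum_(1 <= t < n.+1) inv_cbrt t <= 3 / 2 * (n%:R * inv_cbrt n).
Proof.
elim: n => [|n IH]; first by rewrite big_geq// mul0r mulr0.
rewrite big_nat_recr//=.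
have [->|n0] := posnP n.
  by rewrite big_geq// inv_cbrt1; lra.
apply: (@le_trans _ _ (3 / 2 * (n%:R * inv_cbrt n) + inv_cbrt n.+1)); first by rewrite lerD2r.
set s := inv_cbrt n.+1; set t := inv_cbrt n.
have s0 : 0 < s by exact: inv_cbrt_gt0.
have t0 : 0 < t by exact: inv_cbrt_gt0.
have sE : n.+1%:R = s ^- 3 by rewrite inv_cbrt_cube// invrK.
have tE : n%:R = t ^- 3 by rewrite inv_cbrt_cube// invrK.
have E : s ^- 3 = 1 + t ^- 3 by rewrite -sE -tE -natr1 addrC.
rewrite sE tE.
pose A := s^-1; pose b := t^-1.
have A0 : 0 < A by rewrite invr_gt0.
have b0 : 0 < b by rewrite invr_gt0.
have -> : s ^- 3 * s = A ^+ 2 by rewrite /A; field; rewrite gt_eqF.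
have -> : t ^- 3 * t = b ^+ 2 by rewrite /b; field; rewrite gt_eqF.
have {}E : A ^+ 3 = 1 + b ^+ 3 by rewrite /A /b !exprVn.
have -> : s = A^-1 by rewrite invrK.
rewrite -(ler_pM2r A0) mulrDl mulVf ?gt_eqF//.
have : 0 <= (A - b) ^+ 2 * (A + 2 * b).
  by rewrite mulr_ge0 ?sqr_ge0// addr_ge0 ?mulr_ge0// ltW.
by lra.
Qed.

(** A bound depending continuously on an auxiliary constant N > N0 holds at N0. *)
Lemma ler_sqr_of_gt (X A c m N0 : R) : 0 <= c -> 0 <= m + N0 ->
  (forall N, N0 < N -> X <= A + c * (m + N) ^+ 2) -> X <= A + c * (m + N0) ^+ 2.
Proof.
move=> c0 M0 H; apply/ler_addgt0Pr => e e0.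
pose k := c * (2 * (m + N0) + 1) + 1.
have k0 : 0 < k by rewrite ltr_wpDl// mulr_ge0// addr_ge0// mulr_ge0.
pose de := Num.min 1 (e / k).
have de0 : 0 < de by rewrite lt_min ltr01 divr_gt0.
have de1 : de <= 1 by rewrite ge_min lexx.
have dek : de * k <= e by rewrite -ler_pdivlMr// ge_min lexx orbT.
have := H (N0 + de); rewrite ltrDl => /(_ de0) /le_trans; apply.
have -> : A + c * (m + (N0 + de)) ^+ 2 =
  A + c * (m + N0) ^+ 2 + (de * k - de - c * de * (1 - de)) by rewrite /k; ring.
rewrite lerD2l.
have : 0 <= c * de * (1 - de) by rewrite !mulr_ge0// ?subr_ge0// ltW.
lra.
Qed.

End rates.
Arguments inv_cbrt : clear implicits.

(** * Moment bounds for the estimators *)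

(** The integral of a nonnegative function is a supremum over the simple functions
    below it, hence is monotone on arbitrary functions. This serves for functions
    defined by a supremum over an uncountable set, such as the spectral norm of a
    random matrix or the gap at a random point. *)
Lemma ge0_le_integralT (R : realType) (d : measure_display) (T : measurableType d)
    (mu : {measure set T -> \bar R}) (f h : T -> \bar R) :
  (forall x, 0 <= f x)%E -> (forall x, f x <= h x)%E ->
  (\int[mu]_x f x <= \int[mu]_x h x)%E.
Proof.
move=> f0 fh; have h0 x : (0 <= h x)%E by exact: le_trans (fh x).
rewrite !ge0_integralTE//; apply: le_ereal_sup => _ [k kf <-].
by exists k => // x; exact: le_trans (kf x) (fh x).
Qed.

(** The four groups of terms of the estimator are separated by
    (a + b + c + e)^2 <= 4 (a^2 + b^2 + c^2 + e^2), and the mixed one is reduced to a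
    fourth moment of the score s by 2 G^2 s^2 <= G^4 + s^4. *)
Lemma enorm_hess_bound (R : realType) (d : nat) (g s u : 'cV[R]_d) (Hf Hl : 'M[R]_d)
    (f B G L : R) : `|f| <= B -> enorm g <= G -> specnorm Hf <= L ->
  enorm ((f *: (s *m s^T) + Hf + g *m s^T + f *: Hl + s *m g^T) *m u) ^+ 2 <=
  4 * (((B ^+ 2 + 2) * enorm s ^+ 4 + (L ^+ 2 + 2 * G ^+ 4)) * enorm u ^+ 2
       + B ^+ 2 * enorm (Hl *m u) ^+ 2).
Proof.
move=> fB gG HL; have B0 : 0 <= B := le_trans (normr_ge0 _) fB.
have G0 : 0 <= G := le_trans (enorm_ge0 _) gG.
have L0 : 0 <= L := le_trans (specnorm_ge0 _) HL.
have [[s0 u0] y0] := (enorm_ge0 s, enorm_ge0 u, enorm_ge0 (Hl *m u)).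
have le1 : enorm ((f *: (s *m s^T) + Hf + g *m s^T + f *: Hl + s *m g^T) *m u) <=
    B * enorm s ^+ 2 * enorm u + L * enorm u + 2 * G * enorm s * enorm u
    + B * enorm (Hl *m u).
  have nd (w : 'cV[R]_d) : `|dotp w u| <= enorm w * enorm u.
    by rewrite ler_norml lerNl -dotpNl !(le_trans (dotp_le _ _))// enormN.
  rewrite !mulmxDl -!scalemxAl !outer_mulmx.
  have h1 : enorm (f *: (dotp s u *: s)) <= B * enorm s ^+ 2 * enorm u.
    rewrite !enormZ -mulrA ler_pM ?mulr_ge0//.
    by apply: le_trans (ler_wpM2r s0 (nd s)) _; lra.
  have h2 : enorm (Hf *m u) <= L * enorm u.
    by apply: le_trans (specnorm_le _ _) _; rewrite ler_wpM2r.
  have h3 : enorm (dotp s u *: g) <= G * enorm s * enorm u.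
    by rewrite enormZ mulrC -mulrA ler_pM// enorm_ge0.
  have h4 : enorm (f *: (Hl *m u)) <= B * enorm (Hl *m u).
    by rewrite enormZ ler_wpM2r.
  have h5 : enorm (dotp g u *: s) <= G * enorm s * enorm u.
    rewrite enormZ mulrAC ler_wpM2r//.
    by apply: le_trans (nd _) _; rewrite ler_wpM2r.
  apply: (@le_trans _ _ (B * enorm s ^+ 2 * enorm u + L * enorm u
     + G * enorm s * enorm u + B * enorm (Hl *m u) + G * enorm s * enorm u)).
    by do 4! [apply: le_trans (enormD _ _) _; apply: lerD => //].
  lra.
apply: le_trans (_ : (B * enorm s ^+ 2 * enorm u + L * enorm u
    + 2 * G * enorm s * enorm u + B * enorm (Hl *m u)) ^+ 2 <= _).
  by rewrite ler_sqr// nnegrE ?enorm_ge0// !addr_ge0// !mulr_ge0// exprn_ge0.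
move: (enorm s) (enorm u) (enorm (Hl *m u)) s0 u0 y0 => a b c a0 b0 c0.
have := sqr_ge0 (B * a ^+ 2 * b - L * b).
have := sqr_ge0 (B * a ^+ 2 * b - 2 * G * a * b).
have := sqr_ge0 (B * a ^+ 2 * b - B * c).
have := sqr_ge0 (L * b - 2 * G * a * b).
have := sqr_ge0 (L * b - B * c).
have := sqr_ge0 (2 * G * a * b - B * c).
have := mulr_ge0 (sqr_ge0 b) (sqr_ge0 (G ^+ 2 - a ^+ 2)).
lra.
Qed.

Definition hess_bound (R : realType) (B G L : R) : R :=
  Num.sqrt (4 * B ^+ 2 * G ^+ 4 + 16 * G ^+ 4 + 4 * L ^+ 2 + 4 * B ^+ 2 * L ^+ 2).

Lemma hess_bound_sqr (R : realType) (B G L : R) : hess_bound B G L ^+ 2 =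
  4 * B ^+ 2 * G ^+ 4 + 16 * G ^+ 4 + 4 * L ^+ 2 + 4 * B ^+ 2 * L ^+ 2.
Proof.
rewrite sqr_sqrtr// (_ : G ^+ 4 = (G ^+ 2) ^+ 2); last by rewrite -exprM.
have [B2 G2 L2] := And3 (sqr_ge0 B) (sqr_ge0 (G ^+ 2)) (sqr_ge0 L).
have := mulr_ge0 B2 G2; have := mulr_ge0 B2 L2; lra.
Qed.

(** The integrand and the log-density share one gradient constant G and one Hessian
    constant L, as in the analysis, where they are maxima. *)
Record bounded_model (R : realType) (d : nat) (dZ : measure_display)
    (Z : measurableType dZ) (mu : {measure set Z -> \bar R})
    (Ft : 'cV[R]_d -> Z -> R) (p : Z -> 'cV[R]_d -> R)
    (F : 'cV[R]_d -> R) (K : set 'cV[R]_d) (B G L : R) : Prop := {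
  bounded_model_model : nonoblivious_model mu Ft p K F;
  bounded_model_convex : convex_set K;
  bounded_model_Ft : forall x z, K x -> `|Ft x z| <= B;
  bounded_model_grad_Ft : forall x z, K x -> enorm (grad (Ft^~ z) x) <= G;
  bounded_model_grad_logp : forall x, K x ->
    (density_expectation mu (p^~ x) (fun z => enorm (grad (logp p z) x) ^+ 4)%R
       <= (G ^+ 4)%:E)%E;
  bounded_model_hess_Ft : forall x z, K x -> specnorm (hess (Ft^~ z) x) <= L;
  bounded_model_hess_logp : forall x, K x ->
    (density_expectation mu (p^~ x) (fun z => specnorm (hess (logp p z) x) ^+ 2)%R
       <= (L ^+ 2)%:E)%E
}.

Section model_bounds.
Context {R : realType} {d : nat} {dZ : measure_display} {Z : measurableType dZ}.
Variable mu : {measure set Z -> \bar R}.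
Variables (Ft : 'cV[R]_d -> Z -> R) (p : Z -> 'cV[R]_d -> R).
Variables (F : 'cV[R]_d -> R) (K : set 'cV[R]_d) (B G L : R).
Hypothesis bm : bounded_model mu Ft p F K B G L.

Let model := bounded_model_model bm.
Let K_convex := bounded_model_convex bm.
Let Ft_bound := bounded_model_Ft bm.
Let grad_Ft_bound := bounded_model_grad_Ft bm.
Let grad_logp_bound := bounded_model_grad_logp bm.
Let hess_Ft_bound := bounded_model_hess_Ft bm.
Let hess_logp_bound := bounded_model_hess_logp bm.

Local Notation Lbar := (hess_bound B G L).

Lemma density_ge0 z x : 0 <= p z x.
Proof. exact/ltW/(density_gt0 model). Qed.

Lemma density_continuous z : continuous (p z).
Proof.
have -> : p z = expR \o logp p z.
  apply/funext => x; rewrite /= lnK// posrE; exact: (density_gt0 model).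
move=> x; apply: continuous_comp; last exact: continuous_expR.
by apply: differentiable_continuous; case: (logp_C2 model z).
Qed.

Section joint_measurability.
Context {dT : measure_display} {T : measurableType dT}.
Variables (X : T -> 'cV[R]_d) (zeta : T -> Z).
Hypotheses (mX : mx_measurable_fun X) (mzeta : measurable_fun setT zeta).

Lemma measurable_density : measurable_fun setT (fun w => p (zeta w) (X w)).
Proof.
apply: (@caratheodory_measurable _ _ _ _ _ _ (fun x z => p z x)) => //.
  exact: density_continuous.
exact: (density_measurable model).
Qed.

Lemma measurable_grad_Ft : mx_measurable_fun (fun w => grad (Ft^~ (zeta w)) (X w)).
Proof.
apply: (@caratheodory_measurable_mx _ _ _ _ _ _ _ _ (fun x z => grad (Ft^~ z) x)) => //.
  by move=> z x; apply: differentiable_continuous; case: (Ft_C2 model z).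
exact: (grad_Ft_measurable model).
Qed.

Lemma measurable_grad_logp : mx_measurable_fun (fun w => grad (logp p (zeta w)) (X w)).
Proof.
apply: (@caratheodory_measurable_mx _ _ _ _ _ _ _ _ (fun x z => grad (logp p z) x)) => //.
  by move=> z x; apply: differentiable_continuous; case: (logp_C2 model z).
exact: (grad_logp_measurable model).
Qed.

Lemma measurable_hess_logp : mx_measurable_fun (fun w => hess (logp p (zeta w)) (X w)).
Proof.
apply: (@caratheodory_measurable_mx _ _ _ _ _ _ _ _ (fun x z => hess (logp p z) x)) => //.
  by move=> z; case: (logp_C2 model z).
exact: (hess_logp_measurable model).
Qed.

Lemma measurable_hess_estimator :
  mx_measurable_fun (fun w => hess_estimator Ft p (X w) (zeta w)).
Proof.
have mFt : measurable_fun setT (fun w => Ft (X w) (zeta w)).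
  apply: caratheodory_measurable => //; last exact: (Ft_measurable model).
  by move=> z x; apply: differentiable_continuous; case: (Ft_C2 model z).
have mH : mx_measurable_fun (fun w => hess (Ft^~ (zeta w)) (X w)).
  apply: (@caratheodory_measurable_mx _ _ _ _ _ _ _ _ (fun x z => hess (Ft^~ z) x)) => //.
    by move=> z; case: (Ft_C2 model z).
  exact: (hess_Ft_measurable model).
have mg := measurable_grad_Ft; have ms := measurable_grad_logp.
rewrite /hess_estimator.
apply: mx_measurableD; last exact/mx_measurable_mulmx/mx_measurable_trmx.
apply: mx_measurableD; last exact/mx_measurableZ/measurable_hess_logp.
apply: mx_measurableD; last exact/mx_measurable_mulmx/mx_measurable_trmx.
apply: mx_measurableD => //.
by apply: mx_measurableZ => //; exact/mx_measurable_mulmx/mx_measurable_trmx.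
Qed.

End joint_measurability.

Section at_point.
Variable x : 'cV[R]_d.
Hypothesis Kx : K x.

Let mx : mx_measurable_fun (fun _ : Z => x).
Proof. exact: mx_measurable_cst. Qed.

Let mid : measurable_fun setT (@id Z).
Proof. exact: measurable_id. Qed.

Let mp : measurable_fun setT (p^~ x).
Proof. exact: (measurable_density mx mid). Qed.

Let p0 z : 0 <= p z x. Proof. exact: density_ge0. Qed.

Let has_mean_cst c : has_mean mu (p^~ x) (fun=> c) c.
Proof. by apply: has_mean_cst => //; exact: (density_mass1 model). Qed.

Lemma grad_bound_ge0 : 0 <= G.
Proof. exact: le_trans (enorm_ge0 _) (grad_Ft_bound point Kx). Qed.

Lemma hess_Ft_bound_ge0 : 0 <= L.
Proof. exact: le_trans (specnorm_ge0 _) (hess_Ft_bound point Kx). Qed.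

Lemma objective_bound : `|F x| <= B.
Proof.
have Fx := objectiveE model x.
have FtB z : -B <= Ft x z <= B by rewrite -ler_norml Ft_bound.
rewrite ler_norml; apply/andP; split.
  by apply: (has_mean_le p0 (has_mean_cst _) Fx) => z; case/andP: (FtB z).
by apply: (has_mean_le p0 Fx (has_mean_cst _)) => z; case/andP: (FtB z).
Qed.

Lemma grad_objective_bound : enorm (grad F x) <= G.
Proof.
have G0 := grad_bound_ge0; rewrite -ler_sqr ?nnegrE ?enorm_ge0//.
have mg := measurable_enorm_sqr (measurable_grad_Ft mx mid).
have gG z : enorm (grad (Ft^~ z) x) ^+ 2 <= G ^+ 2.
  by rewrite ler_sqr ?nnegrE ?enorm_ge0// grad_Ft_bound.
have [||c hc cG] := @has_mean_of_le _ _ _ mu _ p0 _ (G ^+ 2) mg mp.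
- by move=> z; exact: sqr_ge0.
- apply: (density_expectation_le p0 mg mp _ gG (has_mean_cst _)) => z.
  exact: sqr_ge0.
apply: le_trans cG.
apply: (enorm_mean_sqr_le p0 _ mp (grad_unbiased model Kx) hc).
exact: (density_mass1 model).
Qed.

(* On a unit vector the norm is below the spectral norm; the other directions
   follow by homogeneity. *)
Let hess_logp_dir (u : 'cV[R]_d) :
  exists2 m, has_mean mu (p^~ x) (fun z => enorm (hess (logp p z) x *m u) ^+ 2) m
           & m <= L ^+ 2 * enorm u ^+ 2.
Proof.
have [u0|u0] := eqVneq (enorm u) 0.
  exists 0; last by rewrite u0 expr0n mulr0.
  rewrite [X in has_mean _ _ X _](_ : _ = fun=> 0); first exact: has_mean0.
  by apply/funext => z; rewrite (enorm_eq0 u0) mulmx0 enorm0 expr0n.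
pose e := (enorm u)^-1 *: u.
have e1 : enorm e = 1.
  by rewrite enormZ ger0_norm ?invr_ge0 ?enorm_ge0// mulVf.
have ue : u = enorm u *: e by rewrite scalerA mulfV// scale1r.
have me : measurable_fun setT (fun z => enorm (hess (logp p z) x *m e) ^+ 2).
  apply: measurable_enorm_sqr; apply: mx_measurable_mulmx.
    exact: (measurable_hess_logp mx mid).
  exact: mx_measurable_cst.
have [||m hm mL] := @has_mean_of_le _ _ _ mu _ p0 _ (L ^+ 2) me mp.
- by move=> z; exact: sqr_ge0.
- apply: le_trans (hess_logp_bound Kx); apply: ge0_le_integralT => z.
    by rewrite lee_fin mulr_ge0// sqr_ge0.
  rewrite lee_fin ler_wpM2r// ler_sqr ?nnegrE ?enorm_ge0 ?specnorm_ge0//.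
  by have := specnorm_le (hess (logp p z) x) e; rewrite e1 mulr1.
exists (enorm u ^+ 2 * m); last by rewrite mulrC ler_wpM2r// sqr_ge0.
rewrite [X in has_mean _ _ X _](_ : _ =
   fun z => enorm u ^+ 2 * enorm (hess (logp p z) x *m e) ^+ 2).
  exact: has_meanZ.
apply/funext => z; rewrite {1}ue -scalemxAr enormZ exprMn.
by rewrite ger0_norm// enorm_ge0.
Qed.

Lemma hess_estimator_mean_sqr (u : 'cV[R]_d) :
  exists2 m, has_mean mu (p^~ x) (fun z => enorm (hess_estimator Ft p x z *m u) ^+ 2) m
           & m <= Lbar ^+ 2 * enorm u ^+ 2.
Proof.
have ms4 : measurable_fun setT (fun z => enorm (grad (logp p z) x) ^+ 4).
  under eq_fun do rewrite (exprM _ 2 2).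
  by apply: measurable_funX; exact: (measurable_enorm_sqr (measurable_grad_logp mx mid)).
have [||s4 hs4 s4G] := @has_mean_of_le _ _ _ mu _ p0 _ (G ^+ 4) ms4 mp.
- by move=> z; rewrite exprn_ge0// enorm_ge0.
- exact: grad_logp_bound.
have [y hy yL] := hess_logp_dir u.
have mest : measurable_fun setT (fun z => enorm (hess_estimator Ft p x z *m u) ^+ 2).
  apply: measurable_enorm_sqr; apply: mx_measurable_mulmx.
    exact: (measurable_hess_estimator mx mid).
  exact: mx_measurable_cst.
have hk := has_meanD (has_meanD (has_meanZ (4 * (B ^+ 2 + 2) * enorm u ^+ 2) hs4)
    (has_mean_cst (4 * (L ^+ 2 + 2 * G ^+ 4) * enorm u ^+ 2)))
  (has_meanZ (4 * B ^+ 2) hy).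
have e0 z : 0 <= enorm (hess_estimator Ft p x z *m u) ^+ 2 by exact: sqr_ge0.
have [|m hm mk] := @has_mean_of_le _ _ _ mu _ p0 _
  (4 * (B ^+ 2 + 2) * enorm u ^+ 2 * s4
   + 4 * (L ^+ 2 + 2 * G ^+ 4) * enorm u ^+ 2 + 4 * B ^+ 2 * y) mest mp e0.
  apply: (density_expectation_le p0 mest mp e0 _ hk) => z.
  apply: le_trans (enorm_hess_bound _ _ _ (Ft_bound _ Kx) (grad_Ft_bound _ Kx)
    (hess_Ft_bound _ Kx)) _.
  by lra.
exists m => //; apply: le_trans mk _; rewrite hess_bound_sqr.
have B2 := sqr_ge0 B.
have c1 : 0 <= 4 * (B ^+ 2 + 2) * enorm u ^+ 2.
  by apply: mulr_ge0; [lra|exact: sqr_ge0].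
have c2 : 0 <= 4 * B ^+ 2 by lra.
have := ler_wpM2l c1 s4G; have := ler_wpM2l c2 yL.
by lra.
Qed.

(** The Hessian is the mean of its estimator, and is thus bounded by the second
    moment of the latter. *)
Lemma hess_objective_bound (u : 'cV[R]_d) : enorm (hess F x *m u) <= Lbar * enorm u.
Proof.
have [m hm mL] := hess_estimator_mean_sqr u.
rewrite -ler_sqr ?nnegrE ?mulr_ge0 ?enorm_ge0 ?sqrtr_ge0// exprMn.
apply: le_trans mL.
apply: (enorm_mean_sqr_le p0 _ mp _ hm); first exact: (density_mass1 model).
by apply: has_mean_mulmx; exact: (hess_unbiased model Kx).
Qed.

End at_point.

Lemma grad_objective_lipschitz x y : K x -> K y ->
  enorm (grad F x - grad F y) <= Lbar * enorm (x - y).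
Proof.
move=> Kx Ky; apply: (grad_lipschitz K_convex (objective_C2 model)) => //.
  by move=> w Kw u; exact: hess_objective_bound.
exact: sqrtr_ge0.
Qed.

Lemma grad_Ft_lipschitz x y z : K x -> K y ->
  enorm (grad (Ft^~ z) x - grad (Ft^~ z) y) <= L * enorm (x - y).
Proof.
move=> Kx Ky; have L0 := hess_Ft_bound_ge0 Kx; apply: (grad_lipschitz K_convex (Ft_C2 model z)) => //.
move=> w Kw u; apply: le_trans (specnorm_le _ _) _.
by rewrite ler_wpM2r ?enorm_ge0// hess_Ft_bound.
Qed.

Lemma objective_descent x y : K x -> K y ->
  F x <= F y + dotp (grad F y) (x - y) + Lbar / 2 * enorm (x - y) ^+ 2.
Proof.
move=> Kx Ky; apply: (descent_lemma K_convex (objective_C2 model)) => //.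
  by move=> w Kw u; exact: hess_objective_bound.
exact: sqrtr_ge0.
Qed.

End model_bounds.

(** * One iteration with a fixed past *)

Section one_step.
Context {R : realType} {d : nat} {dZ : measure_display} {Z : measurableType dZ}.
Variable mu : {measure set Z -> \bar R}.
Variables (Ft : 'cV[R]_d -> Z -> R) (p : Z -> 'cV[R]_d -> R).
Variables (F : 'cV[R]_d -> R) (K : set 'cV[R]_d) (B G L : R).
Hypothesis bm : bounded_model mu Ft p F K B G L.
Local Notation Lbar := (hess_bound B G L).
Let model := bounded_model_model bm.

Variables (x x' g : 'cV[R]_d) (rho N : R).
Hypotheses (Kx : K x) (Kx' : K x') (rho01 : 0 <= rho <= 1) (N0 : 0 < N).
Hypothesis uN : Lbar * enorm (x - x') <= rho * N.

Let u := x - x'.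
Let W := g - grad F x'.
Let Delta := grad F x - grad F x'.
Let b := (L + Lbar) * enorm u.
Let M := 2 * G.
Let al := 1 - rho.
Let y (s : R) := s *: x + (1 - s) *: x'.
Let h (s : R) := hess F (y s) *m u.

(** The error of the gradient estimate after an iteration from x' to x, as a
    function of the position s on the segment and of the sample z; g is the estimate
    before the iteration. *)
Definition update_error (s : R) (z : Z) : 'cV[R]_d :=
  (1 - rho) *: (g + hess_estimator Ft p (s *: x + (1 - s) *: x') z *m (x - x'))
  + rho *: grad (Ft^~ z) x - grad F x.

Let Psi (s : R) := al ^+ 2 * enorm W ^+ 2 + 2 * al * rho * (enorm W * b)
  + 2 * al ^+ 2 * dotp W (h s - Delta)
  + (M + N) * (al ^+ 2 / N * ((Lbar * enorm u) ^+ 2 - 2 * dotp Delta (h s)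
                             + enorm Delta ^+ 2) + rho ^+ 2 * M).

Let update_errorE s z : update_error s z =
  al *: (W + (hess_estimator Ft p (y s) z *m u - Delta))
  + rho *: (grad (Ft^~ z) x - grad F x).
Proof.
rewrite /update_error /al /W /Delta /y /u; apply/colP => i; rewrite !mxE; ring.
Qed.

Let al0 : 0 <= al. Proof. by rewrite subr_ge0; case/andP: rho01. Qed.
Let al1 : al <= 1. Proof. by rewrite gerBl; case/andP: rho01. Qed.
Let rho0 : 0 <= rho. Proof. by case/andP: rho01. Qed.
Let M0 : 0 <= M. Proof. by rewrite mulr_ge0// (grad_bound_ge0 bm Kx). Qed.

(* The error is al (W + V) + rho Y, where V is the noise of the Hessian-vector
   product and Y that of the gradient. The sample is drawn at y s rather than at x,
   so that Y is centered up to the displacement b. The squared norm of the noise is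
   split by (al |V| + rho M)^2 <= (M + N) (al^2 |V|^2 / N + rho^2 M), the difference
   being (M / N) (al |V| - rho N)^2. *)
Let pointwise s z : 0 <= s <= 1 -> enorm (update_error s z) ^+ 2 <=
  al ^+ 2 * enorm W ^+ 2
  + 2 * al ^+ 2 * dotp W (hess_estimator Ft p (y s) z *m u - Delta)
  + 2 * al * rho * (dotp W (grad (Ft^~ z) (y s) - grad F (y s)) + enorm W * b)
  + (M + N) * (al ^+ 2 / N * (enorm (hess_estimator Ft p (y s) z *m u) ^+ 2
        - 2 * dotp Delta (hess_estimator Ft p (y s) z *m u) + enorm Delta ^+ 2)
      + rho ^+ 2 * M).
Proof.
move=> s01; rewrite update_errorE.
set D := hess_estimator Ft p (y s) z *m u; set V := D - Delta.
set Y := grad (Ft^~ z) x - grad F x.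
set Y0 := grad (Ft^~ z) (y s) - grad F (y s).
have Ky : K (y s) by exact: (convex_segment (bounded_model_convex bm)).
have xy : enorm (x - y s) <= enorm u.
  have -> : x - y s = (1 - s) *: u by apply/colP => i; rewrite !mxE; ring.
  rewrite enormZ ger0_norm; last by rewrite subr_ge0; case/andP: s01.
  by rewrite ler_piMl ?enorm_ge0// gerBl; case/andP: s01.
have YM : enorm Y <= M.
  apply: le_trans (enormB _ _) _.
  have := bounded_model_grad_Ft bm z Kx; have := grad_objective_bound bm Kx.
  by rewrite /M; lra.
have YY0 : dotp W Y <= dotp W Y0 + enorm W * b.
  rewrite -lerBlDl -dotpBr; apply: le_trans (dotp_le _ _) _.
  rewrite ler_wpM2l ?enorm_ge0//.
  have -> : Y - Y0 = (grad (Ft^~ z) x - grad (Ft^~ z) (y s))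
      - (grad F x - grad F (y s)) by rewrite /Y /Y0 !opprD !opprK addrACA.
  apply: le_trans (enormB _ _) _; rewrite /b mulrDl.
  apply: lerD.
    apply: le_trans (grad_Ft_lipschitz bm z Kx Ky) _.
    by rewrite ler_wpM2l// (hess_Ft_bound_ge0 bm Kx).
  apply: le_trans (grad_objective_lipschitz bm Kx Ky) _.
  by rewrite ler_wpM2l// sqrtr_ge0.
have VE : enorm V ^+ 2 = enorm D ^+ 2 - 2 * dotp Delta D + enorm Delta ^+ 2.
  exact: enorm_sqrB.
have sq : enorm (al *: V + rho *: Y) ^+ 2 <=
    (M + N) * (al ^+ 2 / N * enorm V ^+ 2 + rho ^+ 2 * M).
  apply: (@le_trans _ _ ((al * enorm V + rho * M) ^+ 2)).
    rewrite ler_sqr ?nnegrE ?enorm_ge0//.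
      apply: le_trans (enormD _ _) _; rewrite !enormZ !ger0_norm//.
      by apply: lerD => //; rewrite ler_wpM2l.
    by rewrite addr_ge0// mulr_ge0// enorm_ge0.
  rewrite -subr_ge0.
  have -> : (M + N) * (al ^+ 2 / N * enorm V ^+ 2 + rho ^+ 2 * M)
      - (al * enorm V + rho * M) ^+ 2
      = M / N * (al * enorm V - rho * N) ^+ 2.
    by field; rewrite gt_eqF.
  by rewrite mulr_ge0 ?sqr_ge0// divr_ge0// ltW.
rewrite VE in sq.
have -> : enorm (al *: (W + V) + rho *: Y) ^+ 2 = al ^+ 2 * enorm W ^+ 2
    + 2 * al ^+ 2 * dotp W V + 2 * al * rho * dotp W Y
    + enorm (al *: V + rho *: Y) ^+ 2.
  rewrite scalerDr -addrA enorm_sqrD enormZ exprMn ger0_norm//.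
  by rewrite dotpZl dotpDr !dotpZr; ring.
have c0 : 0 <= 2 * al * rho by rewrite !mulr_ge0.
apply: lerD; last exact: sq.
by rewrite lerD2l ler_wpM2l.
Qed.

(* After integration over the sample, Psi depends on s only through the
   Hessian-vector product h s, and this in an affine way. *)
Let inner s : 0 <= s <= 1 ->
  (density_expectation mu (p^~ (y s)) (fun z => enorm (update_error s z) ^+ 2)%R
     <= (Psi s)%:E)%E.
Proof.
move=> s01.
have Ky : K (y s) by exact: (convex_segment (bounded_model_convex bm)).
have p0 z : 0 <= p z (y s) by exact: (density_ge0 bm).
have mid : measurable_fun setT (@id Z) by exact: measurable_id.
have my : mx_measurable_fun (fun _ : Z => y s) by exact: mx_measurable_cst.
have mp : measurable_fun setT (p^~ (y s)) by exact: (measurable_density bm my mid).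
have cst c : has_mean mu (p^~ (y s)) (fun=> c) c.
  by apply: has_mean_cst => //; exact: (density_mass1 model).
have [m hm mL] := hess_estimator_mean_sqr bm Ky u.
have hH : has_mean_mx mu (p^~ (y s)) (fun z => hess_estimator Ft p (y s) z *m u) (h s).
  by apply: has_mean_mulmx; exact: (hess_unbiased model Ky).
have hg := grad_unbiased model Ky.
have hH' w := has_mean_dotpl w hH.
have hg' w := has_mean_dotpl w hg.
have HM := has_meanD (has_meanD (has_meanD (cst (al ^+ 2 * enorm W ^+ 2))
    (has_meanZ (2 * al ^+ 2) (has_meanB (hH' W) (cst (dotp W Delta)))))
    (has_meanZ (2 * al * rho) (has_meanD (has_meanB (hg' W) (cst (dotp W (grad F (y s)))))
       (cst (enorm W * b)))))
  (has_meanZ (M + N) (has_meanD (has_meanZ (al ^+ 2 / N)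
    (has_meanD (has_meanB hm (has_meanZ 2 (hH' Delta))) (cst (enorm Delta ^+ 2))))
     (cst (rho ^+ 2 * M)))).
apply: le_trans (density_expectation_le p0 _ mp _ _ HM) _.
- apply: measurable_enorm_sqr.
  have mx : mx_measurable_fun (fun _ : Z => x) by exact: mx_measurable_cst.
  apply: mx_measurableB; last exact: mx_measurable_cst.
  apply: mx_measurableD; apply: mx_measurableZ => //.
  + apply: mx_measurableD; first exact: mx_measurable_cst.
    apply: mx_measurable_mulmx; last exact: mx_measurable_cst.
    exact: (measurable_hess_estimator bm my mid).
  + exact: (measurable_grad_Ft bm mx mid).
- by move=> z; exact: sqr_ge0.
- by move=> z; apply: le_trans (pointwise z s01) _; rewrite (dotpBr _ Delta) (dotpBr _ (grad F (y s))).
rewrite lee_fin /Psi (dotpBr _ Delta) subrr add0r.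
have c0 : 0 <= (M + N) * (al ^+ 2 / N).
  by rewrite mulr_ge0 ?addr_ge0 ?divr_ge0 ?sqr_ge0// ltW.
have {}mL : m <= (Lbar * enorm u) ^+ 2 by rewrite exprMn.
have := ler_wpM2l c0 mL.
by lra.
Qed.

(** Since h has mean Delta over the segment, the noise is orthogonal to the past
    error W except for the bias b, and its variance is below its second moment. The
    positive constant N is constrained by Lbar |x - x'| <= rho N alone, since the
    smallest value allowed by this inequality may be 0. *)
Lemma one_step_bound :
  (\int[lebesgue_measure]_s
     (density_expectation mu (p^~ (s *: x + (1 - s) *: x')%R)
        (fun z => enorm (update_error s z) ^+ 2)%R * (uniform_pdf 0 1 s)%:E)
   <= ((1 - rho) ^+ 2 * enorm (g - grad F x') ^+ 2
       + 2 * (1 - rho) * rho * (enorm (g - grad F x') * ((L + Lbar) * enorm (x - x')))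
       + rho ^+ 2 * (2 * G + N) ^+ 2)%:E)%E.
Proof.
have u0 (s : R) : 0 <= uniform_pdf 0 1 s by exact: uniform_pdf_ge0.
have mu0 := @measurable_uniform_pdf R 0 1.
have cst c : has_mean lebesgue_measure (uniform_pdf (0 : R) 1) (fun=> c) c.
  apply: has_mean_cst => //.
  by rewrite /density_law integral_uniform_pdf1// ltr01.
have hh : has_mean_mx lebesgue_measure (uniform_pdf (0 : R) 1) h Delta.
  by move=> i j; rewrite ord1; exact: hess_line_mean (objective_C2 model).
have hh' w := has_mean_dotpl w hh.
have HM := has_meanD (has_meanD (cst (al ^+ 2 * enorm W ^+ 2 + 2 * al * rho * (enorm W * b)))
    (has_meanZ (2 * al ^+ 2) (has_meanB (hh' W) (cst (dotp W Delta)))))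
  (has_meanZ (M + N) (has_meanD (has_meanZ (al ^+ 2 / N)
    (has_meanD (has_meanB (cst ((Lbar * enorm u) ^+ 2)) (has_meanZ 2 (hh' Delta)))
      (cst (enorm Delta ^+ 2))))
     (cst (rho ^+ 2 * M)))).
apply: le_trans (_ : _ <= density_expectation lebesgue_measure (uniform_pdf 0 1) Psi)%E _.
  apply: ge0_le_integralT => s.
    rewrite mule_ge0 ?lee_fin//; apply: integral_ge0 => z _.
    by rewrite lee_fin mulr_ge0 ?sqr_ge0// (density_ge0 bm).
  rewrite EFinM; have [s01|s01] := boolP (0 <= s <= 1).
    by rewrite lee_wpmul2r ?lee_fin//; exact: inner.
  by rewrite /uniform_pdf (negbTE s01) !mule0.
have -> : Psi = fun s => al ^+ 2 * enorm W ^+ 2 + 2 * al * rho * (enorm W * b)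
  + 2 * al ^+ 2 * (dotp W (h s) - dotp W Delta)
  + (M + N) * (al ^+ 2 / N * ((Lbar * enorm u) ^+ 2 - 2 * dotp Delta (h s)
                             + enorm Delta ^+ 2) + rho ^+ 2 * M).
  by apply/funext => s; rewrite /Psi (dotpBr _ Delta).
rewrite (has_mean_expectation HM) lee_fin subrr mulr0 addr0 -!enorm_sqr.
rewrite -!addrA lerD2l lerD2l.
have NN : (Lbar * enorm u) ^+ 2 <= rho ^+ 2 * N ^+ 2.
  rewrite -exprMn ler_sqr// nnegrE ?mulr_ge0 ?enorm_ge0 ?sqrtr_ge0//.
  exact: ltW.
have al21 : al ^+ 2 <= 1 by rewrite expr_le1.
have a1 : al ^+ 2 / N * ((Lbar * enorm u) ^+ 2 - 2 * enorm Delta ^+ 2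
    + enorm Delta ^+ 2) <= rho ^+ 2 * N.
  apply: (@le_trans _ _ (al ^+ 2 / N * (rho ^+ 2 * N ^+ 2))).
    rewrite ler_wpM2l ?divr_ge0 ?sqr_ge0// ?(ltW N0)//.
    by have := sqr_ge0 (enorm Delta); lra.
  have -> : al ^+ 2 / N * (rho ^+ 2 * N ^+ 2) = al ^+ 2 * (rho ^+ 2 * N).
    by field; rewrite gt_eqF.
  by rewrite ler_piMl// mulr_ge0 ?sqr_ge0// ltW.
have MN : 0 <= M + N by rewrite addr_ge0// ltW.
have := ler_wpM2l MN a1; rewrite -/M.
by lra.
Qed.

End one_step.

(** * Runs of the algorithm *)

Section sub_sigma_algebra.
Context {T : pointedType} {dU : measure_display} {U : measurableType dU}.

Lemma measurable_fun_sub (G1 G2 : set (set T)) (f : T -> U) : <<s G1 >> `<=` <<s G2 >> ->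
  measurable_fun setT (f : g_sigma_algebraType G1 -> U) ->
  measurable_fun setT (f : g_sigma_algebraType G2 -> U).
Proof. by move=> G12 mf mT B mB; apply: G12; exact: mf. Qed.

Lemma measurable_fun_events (G : set (set T)) (f : T -> U) :
  preimage_set_system setT f measurable `<=` <<s G >> ->
  measurable_fun setT (f : g_sigma_algebraType G -> U).
Proof. by move=> fG mT B mB; apply: fG; exists B. Qed.

End sub_sigma_algebra.

Lemma mx_measurable_comp (R : realType) d1 d2 (T : measurableType d1)
    (S : measurableType d2) m n (f : T -> S) (X : S -> 'M[R]_(m, n)) :
  measurable_fun setT f -> mx_measurable_fun X -> mx_measurable_fun (X \o f).
Proof.
by move=> mf mX i j; exact: (measurableT_comp (mX i j)).
Qed.

Lemma measurable_grad_objective (R : realType) (d : nat) (dZ : measure_display)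
    (Z : measurableType dZ) (mu : {measure set Z -> \bar R})
    (Ft : 'cV[R]_d -> Z -> R) (p : Z -> 'cV[R]_d -> R) (F : 'cV[R]_d -> R)
    (K : set 'cV[R]_d) (B G L : R) (bm : bounded_model mu Ft p F K B G L)
    (dT : measure_display) (T : measurableType dT) (X : T -> 'cV[R]_d) :
  mx_measurable_fun X -> mx_measurable_fun (fun w => grad F (X w)).
Proof.
move=> mX.
apply: (@caratheodory_measurable_mx _ _ _ _ _ _ _ _ (fun x (_ : T) => grad F x) X id) => //.
- move=> z x; apply: differentiable_continuous.
  by have [] := objective_C2 (bounded_model_model bm).
- by move=> x; exact: mx_measurable_cst.
Qed.

Lemma measurable_update_error (R : realType) (d : nat) (dZ : measure_display)
    (Z : measurableType dZ) (mu : {measure set Z -> \bar R})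
    (Ft : 'cV[R]_d -> Z -> R) (p : Z -> 'cV[R]_d -> R) (F : 'cV[R]_d -> R)
    (K : set 'cV[R]_d) (B G L rho : R) (bm : bounded_model mu Ft p F K B G L)
    (dT : measure_display) (T : measurableType dT) (X X' g : T -> 'cV[R]_d)
    (s : T -> R) (zeta : T -> Z) :
  mx_measurable_fun X -> mx_measurable_fun X' -> mx_measurable_fun g ->
  measurable_fun setT s -> measurable_fun setT zeta ->
  mx_measurable_fun
    (fun w => update_error Ft p F (X w) (X' w) (g w) rho (s w) (zeta w)).
Proof.
move=> mX mX' mg ms mzeta; rewrite /update_error.
have my : mx_measurable_fun (fun w => s w *: X w + (1 - s w) *: X' w).
  apply: mx_measurableD; apply: mx_measurableZ => //.
  exact: measurable_funB.
apply: mx_measurableB.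
  apply: mx_measurableD; apply: mx_measurableZ => //.
  - apply: mx_measurableD => //; apply: mx_measurable_mulmx.
      exact: (measurable_hess_estimator bm my mzeta).
    exact: mx_measurableB.
  - exact: (measurable_grad_Ft bm mX mzeta).
exact: (measurable_grad_objective bm mX).
Qed.

Section run.
Context {R : realType} {d : nat} {dZ dO : measure_display}.
Context {Z : measurableType dZ} {Omega : measurableType dO}.
Variable mu : {sigma_finite_measure set Z -> \bar R}.
Variables (Ft : 'cV[R]_d -> Z -> R) (p : Z -> 'cV[R]_d -> R).
Variables (F : 'cV[R]_d -> R) (K : set 'cV[R]_d) (B G L : R).
Hypothesis bm : bounded_model mu Ft p F K B G L.
Local Notation Lbar := (hess_bound B G L).
Let model := bounded_model_model bm.

Variable P : probability Omega R.
Variables (T : nat) (x1 : 'cV[R]_d) (rho eta : nat -> R).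
Variables (a : nat -> {RV P >-> R}) (z : nat -> {RV P >-> Z}).
Variables (x g v : nat -> Omega -> 'cV[R]_d).
Hypothesis Kx1 : K x1.
Hypothesis run : sfw_run a z v mu Ft p K x1 rho eta T x g.
Hypothesis rho01 : forall t, (2 <= t <= T)%N -> 0 <= rho t <= 1.
Hypothesis eta01 : forall t, (1 <= t <= T)%N -> 0 <= eta t <= 1.

(* The underlying set of Hist t is Omega: a function of the past of iteration t + 1
   is a measurable function on Hist t. *)
Local Notation Hist t := (g_sigma_algebraType (history a z v t)).
Local Notation HistDraw t := (g_sigma_algebraType (history_draw a z v t)).

Lemma history_closed t : <<s history a z v t >> = history a z v t.
Proof. by apply: sigma_algebra_id; exact: smallest_sigma_algebra. Qed.

Lemma history_draw_closed t : <<s history_draw a z v t >> = history_draw a z v t.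
Proof. by apply: sigma_algebra_id; exact: smallest_sigma_algebra. Qed.

Lemma history_monotone t t' : (t <= t')%N -> history a z v t `<=` history a z v t'.
Proof.
move=> tt'; apply: sub_sigma_algebra2 => E [s [] [/andP[s1 st] sE]]; exists s.
- by constructor 1; rewrite s1 (leq_trans st).
- by constructor 2; rewrite s1 (leq_trans st).
- by constructor 3; rewrite s1 (leq_trans st).
Qed.

Lemma history_sub_draw t : history a z v t.-1 `<=` history_draw a z v t.
Proof. by apply: subset_trans (@sub_sigma_algebra _ _ _); exact: subsetUl. Qed.

Lemma history_measurable t : (t <= T)%N -> history a z v t `<=` measurable.
Proof.
move=> tT; apply: smallest_sub; first exact: sigma_algebra_measurable.
move=> E [s [] [/andP[s1 st]]].
- by move=> [C mC <-]; exact: measurable_funP.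
- by move=> [C mC <-]; exact: measurable_funP.
- move=> [i [C mC <-]]; apply: (run_v_measurable run (t := s)) => //.
  by rewrite s1 (leq_trans st).
Qed.

Lemma history_draw_measurable t : (t.-1 <= T)%N -> history_draw a z v t `<=` measurable.
Proof.
move=> tT; apply: smallest_sub; first exact: sigma_algebra_measurable.
rewrite subUset; split; first exact: history_measurable.
by move=> E [C mC <-]; exact: measurable_funP.
Qed.

Lemma measurable_Hist_monotone t t' m n (X : Omega -> 'M[R]_(m, n)) : (t <= t')%N ->
  mx_measurable_fun (X : Hist t -> _) -> mx_measurable_fun (X : Hist t' -> _).
Proof.
move=> tt' mX i j; apply: measurable_fun_sub (mX i j).
by rewrite !history_closed; exact: history_monotone.
Qed.

Lemma measurable_Hist_draw t m n (X : Omega -> 'M[R]_(m, n)) :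
  mx_measurable_fun (X : Hist t.-1 -> _) -> mx_measurable_fun (X : HistDraw t -> _).
Proof.
move=> mX i j; apply: measurable_fun_sub (mX i j).
by rewrite history_closed history_draw_closed; exact: history_sub_draw.
Qed.

Lemma measurable_Hist_Omega t dU (U : measurableType dU) (X : Omega -> U) : (t <= T)%N ->
  measurable_fun setT (X : Hist t -> _) -> measurable_fun setT X.
Proof.
move=> tT mX mT C mC; apply: (history_measurable tT).
by rewrite -history_closed; exact: mX.
Qed.

Lemma measurable_z t s : (1 <= s <= t)%N -> measurable_fun setT (z s : Hist t -> Z).
Proof.
move=> st; apply: measurable_fun_events => E zE; rewrite history_closed.
by apply: sub_sigma_algebra; exists s; constructor 1.
Qed.

Lemma measurable_a t s : (2 <= s <= t)%N -> measurable_fun setT (a s : Hist t -> R).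
Proof.
move=> st; apply: measurable_fun_events => E zE; rewrite history_closed.
by apply: sub_sigma_algebra; exists s; constructor 2.
Qed.

Lemma measurable_v t s : (1 <= s <= t)%N -> mx_measurable_fun (v s : Hist t -> _).
Proof.
move=> st i j; rewrite (ord1 j); apply: measurable_fun_events => E zE.
rewrite history_closed.
by apply: sub_sigma_algebra; exists s; constructor 3; split => //; exists i.
Qed.

Lemma measurable_a_draw t : measurable_fun setT (a t : HistDraw t -> R).
Proof.
apply: measurable_fun_events => E aE; rewrite history_draw_closed.
by apply: sub_sigma_algebra; right.
Qed.

Lemma measurable_x t : (1 <= t <= T.+1)%N -> mx_measurable_fun (x t : Hist t.-1 -> _).
Proof.
elim: t => // -[_ _|t IH].
  have -> : x 1%N = fun=> x1 by apply/funext => w; exact: (run_x1 run).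
  exact: mx_measurable_cst.
move=> tT; have t1T : (1 <= t.+1 <= T)%N by rewrite ltnS in tT.
have -> : x t.+2 = fun w => x t.+1 w + eta t.+1 *: (v t.+1 w - x t.+1 w).
  by apply/funext => w; exact: (run_x run).
have mx : mx_measurable_fun (x t.+1 : Hist t.+1 -> _).
  apply: (@measurable_Hist_monotone t) => //; apply: IH.
  by move: tT; clear; lia.
apply: mx_measurableD => //; apply: mx_measurableZ => //.
by apply: mx_measurableB => //; apply: measurable_v; rewrite leqnn.
Qed.

Lemma measurable_g t : (1 <= t <= T)%N -> mx_measurable_fun (g t : Hist t -> _).
Proof.
elim: t => // -[_ _|t IH].
  have -> : g 1%N = fun w => grad (Ft^~ (z 1%N w)) x1.
    by apply/funext => w; exact: (run_g1 run).
  apply: (measurable_grad_Ft bm); first exact: mx_measurable_cst.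
  exact: measurable_z.
move=> tT; have tT' : (1 < t.+2 <= T)%N by [].
have -> : g t.+2 = fun w => (1 - rho t.+2) *: (g t.+1 w
     + hess_estimator Ft p (interp_point a x t.+2 w) (z t.+2 w)
        *m (x t.+2 w - x t.+1 w))
     + rho t.+2 *: grad (Ft^~ (z t.+2 w)) (x t.+2 w).
  by apply/funext => w; exact: (run_g run).
have mz : measurable_fun setT (z t.+2 : Hist t.+2 -> _).
  by apply: measurable_z; rewrite leqnn.
have mxx : mx_measurable_fun (x t.+2 : Hist t.+2 -> _).
  by apply: (@measurable_Hist_monotone t.+1) => //; apply: (@measurable_x t.+2); move: tT; clear; lia.
have mxx' : mx_measurable_fun (x t.+1 : Hist t.+2 -> _).
  by apply: (@measurable_Hist_monotone t); [lia|]; apply: (@measurable_x t.+1); move: tT; clear; lia.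
have ma : measurable_fun setT (a t.+2 : Hist t.+2 -> _).
  by apply: measurable_a; rewrite leqnn.
have mg : mx_measurable_fun (g t.+1 : Hist t.+2 -> _).
  by apply: (@measurable_Hist_monotone t.+1) => //; apply: IH; move: tT; clear; lia.
apply: mx_measurableD; apply: mx_measurableZ => //.
- apply: mx_measurableD => //; apply: mx_measurable_mulmx; last exact: mx_measurableB.
  apply: (measurable_hess_estimator bm) => //.
  apply: mx_measurableD; apply: mx_measurableZ => //; exact: measurable_funB.
- exact: (measurable_grad_Ft bm).
Qed.

Lemma run_in_K t w : (1 <= t <= T.+1)%N -> K (x t w).
Proof.
elim: t => // -[_ _|t IH tT]; first by rewrite (run_x1 run).
rewrite (run_x run)//; apply: convex_line (bounded_model_convex bm) _ _ _.
- by have [] := run_v run (t := t.+1) _ w.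
- by apply: IH; move: tT; clear; lia.
- exact: eta01.
Qed.

Definition grad_error t w := g t w - grad F (x t w).

Lemma measurable_grad_error t : (1 <= t <= T)%N ->
  mx_measurable_fun (grad_error t : Hist t -> _).
Proof.
move=> tT; apply: mx_measurableB; first exact: measurable_g.
apply: (measurable_grad_objective bm).
apply: (@measurable_Hist_monotone t.-1); first exact: leq_pred.
by apply: measurable_x; move: tT; clear; lia.
Qed.

Lemma measurable_grad_error_sqr t : (1 <= t <= T)%N ->
  measurable_fun setT (fun w => enorm (grad_error t w) ^+ 2).
Proof.
move=> tT; apply: (@measurable_Hist_Omega t); first by move: tT; clear; lia.
apply: (@measurable_enorm_sqr R _ (Hist t)); exact: measurable_grad_error.
Qed.

(** Two disintegrations: the sample is integrated out given the past and the
    position on the segment, then the position given the past, of which it is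
    independent. *)
Lemma grad_error_conditional t : (2 <= t <= T)%N ->
  (\int[P]_w (enorm (grad_error t w) ^+ 2)%:E =
   \int[P]_w \int[lebesgue_measure]_s
     (density_expectation mu (p^~ (s *: x t w + (1 - s) *: x t.-1 w)%R)
        (fun zz => enorm (update_error Ft p F (x t w) (x t.-1 w) (g t.-1 w) (rho t) s zz)
           ^+ 2)%R
      * (uniform_pdf 0 1 s)%:E))%E.
Proof.
move=> tT.
pose U w (s : R) zz := enorm (update_error Ft p F (x t w) (x t.-1 w) (g t.-1 w) (rho t) s zz) ^+ 2.
pose y w (s : R) := s *: x t w + (1 - s) *: x t.-1 w.
have mx : mx_measurable_fun (x t : Hist t.-1 -> _) by apply: measurable_x; move: tT; clear; lia.
have mx' : mx_measurable_fun (x t.-1 : Hist t.-1 -> _).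
  apply: (@measurable_Hist_monotone t.-2); first exact: leq_pred.
  by apply: measurable_x; move: tT; clear; lia.
have mg : mx_measurable_fun (g t.-1 : Hist t.-1 -> _).
  by apply: measurable_g; move: tT; clear; lia.
have t1T : (t.-1 <= T)%N by move: tT; clear; lia.
pose q1 (w : HistDraw t) (zz : Z) := p zz (y w (a t w)).
have q10 w zz : 0 <= q1 w zz by exact: (density_ge0 bm).
have mX1 : measurable_fun setT (id : Omega -> HistDraw t).
  move=> _ C mC; rewrite setTI; apply: (history_draw_measurable t1T).
  by rewrite -history_draw_closed.
have mX2 : measurable_fun setT (id : Omega -> Hist t.-1).
  move=> _ C mC; rewrite setTI; apply: (history_measurable t1T).
  by rewrite -history_closed.
have mzt : measurable_fun setT (z t : Omega -> Z) by [].
have mat : measurable_fun setT (a t : Omega -> R) by [].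
have fst1 : measurable_fun setT (fst : HistDraw t * Z -> HistDraw t) by exact: measurable_fst.
have snd1 : measurable_fun setT (snd : HistDraw t * Z -> Z) by exact: measurable_snd.
have a1 : measurable_fun setT (fun wz : HistDraw t * Z => a t wz.1).
  exact: (measurableT_comp (@measurable_a_draw t)).
have x1' := mx_measurable_comp fst1 (measurable_Hist_draw mx).
have x1'' := mx_measurable_comp fst1 (measurable_Hist_draw mx').
have g1' := mx_measurable_comp fst1 (measurable_Hist_draw mg).
have mq1 : measurable_fun setT (fun wz : HistDraw t * Z => q1 wz.1 wz.2).
  apply: (measurable_density bm) => //.
  by apply: mx_measurableD; apply: mx_measurableZ => //; exact: measurable_funB.
have c1 E C : measurable E -> measurable C ->
  (P ((id : Omega -> HistDraw t) @^-1` E `&` z t @^-1` C) =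
   \int[P]_(w in (id : Omega -> HistDraw t) @^-1` E) density_law mu (q1 w) C)%E.
  by move=> mE mC; apply: (run_z run tT) => //; rewrite -history_draw_closed.
have D1 := @disintegration _ _ _ _ _ _ _ P mu (id : Omega -> HistDraw t) (z t) q1
  mX1 mzt q10 mq1 c1 (fun wz => (U wz.1 (a t wz.1) wz.2)%:E).
have -> : (\int[P]_w (enorm (grad_error t w) ^+ 2)%:E =
    \int[P]_w (U w (a t w) (z t w))%:E)%E.
  by apply: eq_integral => w _; rewrite /grad_error (run_g run).
rewrite {}D1; first last.
- by move=> wz; rewrite lee_fin sqr_ge0.
- apply/measurable_EFinP/measurable_enorm_sqr.
  exact: (measurable_update_error _ bm x1' x1'' g1').
pose f2 (ws : Hist t.-1 * R) := density_expectation mu (p^~ (y ws.1 ws.2)) (U ws.1 ws.2).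
have f20 ws : (0 <= f2 ws)%E.
  apply: integral_ge0 => zz _; rewrite lee_fin mulr_ge0 ?sqr_ge0//.
  exact: (density_ge0 bm).
have fst2 : measurable_fun setT (fst : Hist t.-1 * R -> Hist t.-1) by exact: measurable_fst.
have snd2 : measurable_fun setT (snd : Hist t.-1 * R -> R) by exact: measurable_snd.
have fst3 : measurable_fun setT (fst : (Hist t.-1 * R) * Z -> Hist t.-1 * R).
  exact: measurable_fst.
have snd3 : measurable_fun setT (snd : (Hist t.-1 * R) * Z -> Z) by exact: measurable_snd.
have s3 : measurable_fun setT (fun wz : (Hist t.-1 * R) * Z => wz.1.2).
  exact: (measurableT_comp snd2).
have x3' := mx_measurable_comp fst3 (mx_measurable_comp fst2 mx).
have x3'' := mx_measurable_comp fst3 (mx_measurable_comp fst2 mx').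
have g3' := mx_measurable_comp fst3 (mx_measurable_comp fst2 mg).
have mf2 : measurable_fun setT f2.
  apply: (@measurable_density_integral _ _ _ _ _ mu
    (fun (ws : Hist t.-1 * R) zz => p zz (y ws.1 ws.2)) _ _
    (fun wsz => (U wsz.1.1 wsz.1.2 wsz.2)%:E)).
  - by move=> ws zz; exact: (density_ge0 bm).
  - apply: (measurable_density bm) => //.
    by apply: mx_measurableD; apply: mx_measurableZ => //; exact: measurable_funB.
  - apply/measurable_EFinP/measurable_enorm_sqr.
    exact: (measurable_update_error _ bm x3' x3'' g3').
  - by move=> wsz; rewrite lee_fin sqr_ge0.
pose q2 (w : Hist t.-1) (s : R) := uniform_pdf (0 : R) 1 s.
have q20 w s : 0 <= q2 w s by exact: uniform_pdf_ge0.
have mq2 : measurable_fun setT (fun ws : Hist t.-1 * R => q2 ws.1 ws.2).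
  exact: (measurableT_comp (measurable_uniform_pdf 0 1)).
have c2 E C : measurable E -> measurable C ->
  (P ((id : Omega -> Hist t.-1) @^-1` E `&` a t @^-1` C) =
   \int[P]_(w in (id : Omega -> Hist t.-1) @^-1` E) density_law lebesgue_measure (q2 w) C)%E.
  move=> mE mC; have hE : history a z v t.-1 E by rewrite -history_closed.
  rewrite (run_a_indep run tT)// (run_a_uniform run tT)//.
  transitivity (\int[P]_(w in E) cst (uniform_prob (@ltr01 R) C) w)%E; last by [].
  by rewrite integral_cst; [rewrite muleC|exact: (history_measurable t1T)].
have D2 := @disintegration _ _ _ _ _ _ _ P lebesgue_measure (id : Omega -> Hist t.-1) (a t) q2
  mX2 mat q20 mq2 c2 f2 mf2 f20.
exact: D2.
Qed.

Lemma grad_error_step t N : (2 <= t <= T)%N -> 0 < N ->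
  (forall w, Lbar * enorm (x t w - x t.-1 w) <= rho t * N) ->
  (\int[P]_w (enorm (grad_error t w) ^+ 2)%:E <=
   \int[P]_w ((1 - rho t) ^+ 2 * enorm (grad_error t.-1 w) ^+ 2
     + 2 * (1 - rho t) * rho t
       * (enorm (grad_error t.-1 w) * ((L + Lbar) * enorm (x t w - x t.-1 w)))
     + rho t ^+ 2 * (2 * G + N) ^+ 2)%:E)%E.
Proof.
move=> tT N0 xN; rewrite grad_error_conditional//.
apply: ge0_le_integralT => w.
  apply: integral_ge0 => s _; rewrite mule_ge0 ?lee_fin ?uniform_pdf_ge0//.
  apply: integral_ge0 => zz _; rewrite lee_fin mulr_ge0 ?sqr_ge0//.
  exact: (density_ge0 bm).
apply: (one_step_bound bm) => //.
- by apply: run_in_K; move: tT; clear; lia.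
- by apply: run_in_K; move: tT; clear; lia.
- exact: rho01.
Qed.

Local Notation D := (diameter K).
Hypothesis K_compact : compact K.
Hypothesis T_gt0 : (1 <= T)%N.
Hypothesis rhoE : forall t, (2 <= t <= T)%N -> rho t = inv_cbrt R t.-1 ^+ 2.
Hypothesis etaE : forall t, (1 <= t <= T)%N -> eta t = inv_cbrt R T ^+ 2.
Let kappa : R := 4 / 3 - inv_cbrt R 2 ^+ 2.
Variable C : R.
Hypothesis C_noise : 2 * (2 * G + D * Lbar) ^+ 2 / kappa <= C.
Hypothesis C_kappa : (2 / kappa) ^+ 4 <= C.
Hypothesis C_bias : (2 * D * (Lbar + L)) ^+ 4 <= C.

Let D0 : 0 <= D.
Proof. by apply: le_trans (enorm_le_diameter K_compact Kx1 Kx1); exact: enorm_ge0. Qed.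

Let G0 : 0 <= G. Proof. exact: (grad_bound_ge0 bm Kx1). Qed.
Let L0 : 0 <= L. Proof. exact: (hess_Ft_bound_ge0 bm Kx1). Qed.
Let Lbar0 : 0 <= Lbar. Proof. exact: sqrtr_ge0. Qed.

Let nu3 : inv_cbrt R 2 ^+ 3 = 2^-1. Proof. exact: inv_cbrt_cube. Qed.
Let nu0 : 0 < inv_cbrt R 2. Proof. exact: inv_cbrt_gt0. Qed.

Let kappa_bounds : 0 < kappa <= 2.
Proof.
have [n2 n1] := cbrt_half_bounds nu0 nu3.
have n2' : inv_cbrt R 2 ^+ 2 < 1 by rewrite expr_lt1// ltW.
by rewrite /kappa; apply/andP; split; lra.
Qed.

Let C0 : 0 < C.
Proof.
have /andP[k0 _] := kappa_bounds.
by apply: lt_le_trans C_kappa; rewrite exprn_gt0// divr_gt0.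
Qed.

Let rate t : R := Num.sqrt C * inv_cbrt R t.

Let rate_gt0 t : (0 < t)%N -> 0 < rate t.
Proof. by move=> t0; rewrite mulr_gt0 ?sqrtr_gt0// inv_cbrt_gt0. Qed.

Let rate_sqr t : rate t ^+ 2 = C * inv_cbrt R t ^+ 2.
Proof. by rewrite exprMn sqr_sqrtr// ltW. Qed.

Local Notation has_expectation := (has_mean P (fun=> 1)).

Let one0 (w : Omega) : 0 <= (1 : R). Proof. exact: ler01. Qed.
Let mone : measurable_fun setT (fun _ : Omega => 1 : R).
Proof. exact: measurable_cst. Qed.

Let expectationE h : density_expectation P (fun=> 1) h = (\int[P]_w (h w)%:E)%E.
Proof. by apply: eq_integral => w _; rewrite mulr1. Qed.

Let has_expectation_cst c : has_expectation (fun=> c) c.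
Proof.
apply: has_mean_cst => //.
rewrite /density_law integral_cst// mul1e; exact: probability_setT.
Qed.

Let has_expectation_of_le (h : Omega -> R) (c : R) : measurable_fun setT h -> (forall w, 0 <= h w) ->
  (\int[P]_w (h w)%:E <= c%:E)%E -> exists2 m, has_expectation h m & m <= c.
Proof.
move=> mh h0 hc; apply: (@has_mean_of_le _ _ _ P _ one0 _ c mh mone h0).
by rewrite expectationE.
Qed.

(* A pointwise substitute for Jensen's inequality: when r^2 bounds the second moment
   of W, the mean of the right-hand side is at most r. *)
Let enorm_le_rate (W : 'cV[R]_d) r : 0 < r -> enorm W <= (enorm W ^+ 2 / r + r) / 2.
Proof.
move=> r0; have := sqr_ge0 (enorm W - r) => H.
rewrite -(ler_pM2r r0) (_ : _ / 2 * r = (enorm W ^+ 2 + r ^+ 2) / 2); first by lra.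
by field; rewrite gt_eqF.
Qed.

Let increment_le t w : (2 <= t <= T)%N ->
  enorm (x t w - x t.-1 w) <= D * inv_cbrt R t.-1 ^+ 2.
Proof.
case: t => [//|[//|t]] tT /=; have t1T : (1 <= t.+1 <= T)%N by move: tT; clear; lia.
rewrite (run_x run)// addrAC subrr add0r enormZ mulrC.
have vK : K (v t.+1 w) by have [] := run_v run t1T w.
have xK : K (x t.+1 w) by apply: run_in_K; move: tT; clear; lia.
rewrite etaE// ger0_norm ?sqr_ge0//.
apply: ler_pM; rewrite ?enorm_ge0 ?sqr_ge0//; first exact: enorm_le_diameter.
by rewrite ler_pXn2r ?nnegrE ?powR_ge0//; apply: inv_cbrt_le; move: tT; clear; lia.
Qed.

Let grad_error_first w : enorm (grad_error 1 w) ^+ 2 <= (2 * G) ^+ 2.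
Proof.
rewrite ler_sqr ?nnegrE ?enorm_ge0 ?mulr_ge0// /grad_error (run_x1 run) (run_g1 run).
apply: le_trans (enormB _ _) _.
have := bounded_model_grad_Ft bm (z 1%N w) Kx1; have := grad_objective_bound bm Kx1.
by lra.
Qed.

Let noise_le : (2 * G) ^+ 2 <= C.
Proof.
have /andP[k0 k2] := kappa_bounds; apply: le_trans C_noise.
rewrite ler_pdivlMr// mulrC.
have : (2 * G) ^+ 2 <= (2 * G + D * Lbar) ^+ 2.
  by rewrite ler_pXn2r ?nnegrE ?addr_ge0 ?mulr_ge0// lerDl mulr_ge0.
have := sqr_ge0 (2 * G) => h1 h2.
by apply: ler_pM => //; exact: ltW.
Qed.

(** Induction on t. The bias of an iteration is at most b, the step size being at
    most tau^2. The recursion holds for every N > D Lbar, and N is then brought down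
    to D Lbar in order to reach the constant of C_noise. *)
Lemma grad_error_mean_sqr t : (1 <= t <= T)%N ->
  exists2 m, has_expectation (fun w => enorm (grad_error t w) ^+ 2) m
           & m <= C * inv_cbrt R t ^+ 2.
Proof.
elim: t => // -[_|t IH] tT.
  apply: has_expectation_of_le; first exact: (measurable_grad_error_sqr tT).
    by move=> w; exact: sqr_ge0.
  rewrite inv_cbrt1 expr1n mulr1.
  apply: le_trans (_ : (((2 * G) ^+ 2)%:E <= _)%E); last by rewrite lee_fin.
  rewrite -(has_mean_expectation (has_expectation_cst ((2 * G) ^+ 2))) expectationE.
  apply: ge0_le_integralT => w; first by rewrite lee_fin sqr_ge0.
  by rewrite lee_fin grad_error_first.
have t1T : (1 <= t.+1 <= T)%N by move: tT; clear; lia.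
have [m hm mC] := IH t1T.
set tau := inv_cbrt R t.+1 in mC *.
have tau0 : 0 < tau by exact: inv_cbrt_gt0.
have tau1 : tau <= 1 by rewrite -(@inv_cbrt1 R); apply: inv_cbrt_le.
have rhoT : rho t.+2 = tau ^+ 2 by rewrite rhoE.
have al0 : 0 <= 1 - tau ^+ 2 by rewrite subr_ge0 expr_le1// ltW.
pose r := rate t.+1; have r0 : 0 < r by exact: rate_gt0.
have rE : r ^+ 2 = C * tau ^+ 2 by exact: rate_sqr.
pose b := (L + Lbar) * (D * tau ^+ 2).
have b0 : 0 <= b by rewrite mulr_ge0 ?addr_ge0// mulr_ge0// sqr_ge0.
pose A := (1 - tau ^+ 2) ^+ 2 * (C * tau ^+ 2)
  + (1 - tau ^+ 2) * tau ^+ 2 * (2 * b) * r.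
have bound N : D * Lbar < N ->
    (\int[P]_w (enorm (grad_error t.+2 w) ^+ 2)%:E
      <= (A + (tau ^+ 2) ^+ 2 * (2 * G + N) ^+ 2)%:E)%E.
  move=> DN; have N0 : 0 < N by apply: le_lt_trans DN; rewrite mulr_ge0.
  have uN w : Lbar * enorm (x t.+2 w - x t.+1 w) <= rho t.+2 * N.
    apply: (@le_trans _ _ (Lbar * (D * tau ^+ 2))).
      by rewrite ler_wpM2l// increment_le.
    rewrite rhoT mulrA mulrC ler_wpM2l ?sqr_ge0// mulrC; exact: ltW.
  apply: le_trans (grad_error_step (t := t.+2) tT N0 uN) _; rewrite rhoT.
  have hk := has_meanD (has_meanZ ((1 - tau ^+ 2) ^+ 2 + (1 - tau ^+ 2) * tau ^+ 2 * b / r) hm)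
    (has_expectation_cst ((1 - tau ^+ 2) * tau ^+ 2 * b * r
       + (tau ^+ 2) ^+ 2 * (2 * G + N) ^+ 2)).
  apply: (@le_trans _ _ (density_expectation P (fun=> 1) (fun w =>
     ((1 - tau ^+ 2) ^+ 2 + (1 - tau ^+ 2) * tau ^+ 2 * b / r)
       * enorm (grad_error t.+1 w) ^+ 2
     + ((1 - tau ^+ 2) * tau ^+ 2 * b * r + (tau ^+ 2) ^+ 2 * (2 * G + N) ^+ 2)))).
    have c0 : 0 <= 2 * (1 - tau ^+ 2) * tau ^+ 2.
      by apply: mulr_ge0; [exact: mulr_ge0|exact: sqr_ge0].
    rewrite expectationE; apply: ge0_le_integralT => w.
      have q1 : 0 <= enorm (grad_error t.+1 w) * ((L + Lbar) * enorm (x t.+2 w - x t.+1 w)).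
        apply: mulr_ge0; first exact: enorm_ge0.
        by apply: mulr_ge0; [exact: addr_ge0|exact: enorm_ge0].
      rewrite lee_fin; have := mulr_ge0 c0 q1.
      have := mulr_ge0 (sqr_ge0 (1 - tau ^+ 2)) (sqr_ge0 (enorm (grad_error t.+1 w))).
      by have := mulr_ge0 (sqr_ge0 (tau ^+ 2)) (sqr_ge0 (2 * G + N)); lra.
    rewrite lee_fin /=.
    have h1 : enorm (grad_error t.+1 w) * ((L + Lbar) * enorm (x t.+2 w - x t.+1 w)) <=
        (enorm (grad_error t.+1 w) ^+ 2 / r + r) / 2 * b.
      apply: ler_pM; rewrite ?enorm_ge0 ?mulr_ge0 ?addr_ge0 ?enorm_ge0//.
        exact: enorm_le_rate.
      by rewrite ler_wpM2l ?addr_ge0// increment_le.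
    have := ler_wpM2l c0 h1.
    by lra.
  rewrite (has_mean_expectation hk) lee_fin.
  have c1 : 0 <= (1 - tau ^+ 2) ^+ 2 + (1 - tau ^+ 2) * tau ^+ 2 * b / r.
    apply: addr_ge0; [exact: sqr_ge0|apply: divr_ge0; last exact: ltW].
    by apply: mulr_ge0 => //; apply: mulr_ge0 => //; exact: sqr_ge0.
  have e : ((1 - tau ^+ 2) ^+ 2 + (1 - tau ^+ 2) * tau ^+ 2 * b / r) * r ^+ 2 =
      (1 - tau ^+ 2) ^+ 2 * r ^+ 2 + (1 - tau ^+ 2) * tau ^+ 2 * b * r.
    by field; rewrite gt_eqF.
  have := ler_wpM2l c1 mC; rewrite -rE e /A -rE.
  by lra.
have [|m' hm' _] := @has_expectation_of_le (fun w => enorm (grad_error t.+2 w) ^+ 2)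
   (A + (tau ^+ 2) ^+ 2 * (2 * G + (D * Lbar + 1)) ^+ 2)
   (measurable_grad_error_sqr tT) (fun w => sqr_ge0 _).
  by apply: bound; rewrite ltrDl.
exists m' => //.
have m'A : m' <= A + (tau ^+ 2) ^+ 2 * (2 * G + D * Lbar) ^+ 2.
  apply: ler_sqr_of_gt; first exact: sqr_ge0.
    by apply: addr_ge0; exact: mulr_ge0.
  by move=> N /bound; rewrite -expectationE (has_mean_expectation hm') lee_fin.
apply: le_trans m'A _; rewrite /A /r /rate -/tau.
rewrite (_ : 2 * b = (2 * D * (Lbar + L)) * tau ^+ 2); last by rewrite /b; ring.
apply: (@error_rate_step _ C _ _ (inv_cbrt R 2)) => //.
- by rewrite tau0.
- move=> t1; apply: inv_cbrt_le; rewrite /= ltnS lt0n.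
  by apply: contraTneq t1 => t0; rewrite /tau t0 inv_cbrt1 ltxx.
- exact: inv_cbrt_gt0.
- exact: inv_cbrt_succ.
- by apply: mulr_ge0; [exact: mulr_ge0|exact: addr_ge0].
Qed.

Local Notation eta_T := (inv_cbrt R T ^+ 2).
Let eta_gt0 : 0 < eta_T. Proof. by rewrite exprn_gt0// inv_cbrt_gt0. Qed.

Let gap_bound t w := (F (x t w) - F (x t.+1 w)) / eta_T
  + D * enorm (grad_error t w) + Lbar / 2 * eta_T * D ^+ 2.

(** Up to a second-order term, F decreases by at least eta grad F(x).(x - v), where
    v minimizes against the estimate instead of the gradient; replacing v by the
    optimal point for the gradient costs at most D times the error. *)
Lemma fw_gap_le t w : (1 <= t <= T)%N -> 0 <= fw_gap K F (x t w) <= gap_bound t w.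
Proof.
move=> tT; have Kx : K (x t w) by apply: run_in_K; move: tT; clear; lia.
have Kx' : K (x t.+1 w) by apply: run_in_K; move: tT; clear; lia.
have [Kv vmin] := run_v run tT w.
have ub u : K u -> dotp (u - x t w) (- grad F (x t w)) <= gap_bound t w.
  move=> Ku; have xE : x t.+1 w - x t w = eta_T *: (v t w - x t w).
    by rewrite (run_x run tT) etaE// addrAC subrr add0r.
  have := objective_descent bm Kx' Kx.
  rewrite xE dotpZr enormZ ger0_norm ?(ltW eta_gt0)//.
  set w' := v t w - x t w => desc.
  have h1 : dotp (grad F (x t w)) w' <=
      dotp (u - x t w) (grad F (x t w)) + D * enorm (grad_error t w).
    have gE : grad F (x t w) = g t w - grad_error t w by rewrite /grad_error opprB addrC subrK.
    have := vmin u Ku.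
    have e1 : dotp (u - v t w) (grad_error t w) <= D * enorm (grad_error t w).
      apply: le_trans (dotp_le _ _) _; rewrite ler_wpM2r ?enorm_ge0//.
      exact: enorm_le_diameter.
    move: (grad_error t w) gE e1 => e -> e1 vu.
    by rewrite /w' dotpC; move: e1; rewrite !dotpBl !dotpBr; lra.
  have h2 : enorm w' ^+ 2 <= D ^+ 2.
    by rewrite ler_pXn2r ?nnegrE ?enorm_ge0//; exact: enorm_le_diameter.
  have th0 : 0 < inv_cbrt R T by exact: inv_cbrt_gt0.
  rewrite dotpNr /gap_bound -(ler_pM2r eta_gt0).
  have -> : ((F (x t w) - F (x t.+1 w)) / eta_T + D * enorm (grad_error t w)
      + Lbar / 2 * eta_T * D ^+ 2) * eta_T =
    F (x t w) - F (x t.+1 w) + eta_T * (D * enorm (grad_error t w))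
      + Lbar / 2 * (eta_T ^+ 2 * D ^+ 2) by field; rewrite gt_eqF.
  have c1 : 0 <= Lbar / 2 * eta_T ^+ 2 by rewrite mulr_ge0 ?divr_ge0 ?sqr_ge0.
  have := ler_wpM2l c1 h2; have := ler_wpM2l (ltW eta_gt0) h1.
  by move: desc; rewrite exprMn; lra.
have ne : [set dotp (u - x t w) (- grad F (x t w)) | u in K] !=set0.
  by exists (dotp (x t w - x t w) (- grad F (x t w))); exists (x t w).
rewrite /fw_gap; apply/andP; split; last by apply: ge_sup => // _ [u Ku <-]; exact: ub.
apply: ub_le_sup; last by exists (x t w) => //; rewrite subrr dotp0l.
by exists (gap_bound t w) => _ [u Ku <-]; exact: ub.
Qed.

Let measurable_gap_bound t : (1 <= t <= T)%N ->
  measurable_fun setT (gap_bound t : Hist T -> R).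
Proof.
move=> tT; have mF s : (s <= T.+1)%N -> (1 <= s)%N ->
    measurable_fun setT ((fun w => F (x s w)) : Hist T -> R).
  move=> sT s1; apply: (@caratheodory_measurable _ _ _ _ (Hist T) (Hist T)
    (fun y _ => F y) (x s) id) => //.
    move=> _ y; apply: differentiable_continuous.
    by have [] := objective_C2 model.
  by apply: (@measurable_Hist_monotone s.-1); [by rewrite -ltnS prednK|apply: measurable_x; rewrite s1].
apply: measurable_funD; last exact: measurable_cst.
apply: measurable_funD.
  apply: measurable_funM; last exact: measurable_cst.
  by apply: measurable_funB; apply: mF; move: tT; clear; lia.
apply: measurable_funM; first exact: measurable_cst.
apply: (@measurable_enorm R _ (Hist T)).
by apply: (@measurable_Hist_monotone t); [by case/andP: tT|exact: measurable_grad_error].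
Qed.

Variable o : {RV P >-> nat}.
Hypothesis output : uniform_output_index a z v T o.

Let measurable_indicator t : measurable_fun setT (fun n : nat => (n == t)%:R : R).
Proof. by []. Qed.

(* The index o is independent of the run, so that it is integrated out by a
   disintegration whose density is 1 with respect to the law of o. *)
Let expectation_index t (h : Omega -> R) : (1 <= t <= T)%N -> (forall w, 0 <= h w) ->
  measurable_fun setT (h : Hist T -> R) ->
  (\int[P]_w (h w * (o w == t)%:R)%:E = (T%:R^-1)%:E * \int[P]_w (h w)%:E)%E.
Proof.
move=> tT h0 mh.
have mX : measurable_fun setT (id : Omega -> Hist T).
  move=> _ E mE; rewrite setTI; apply: (history_measurable (leqnn T)).
  by rewrite -history_closed.
pose q (w : Hist T) (n : nat) : R := 1.
pose f (wn : Hist T * nat) := (h wn.1 * (wn.2 == t)%:R)%:E.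
have mf : measurable_fun setT f.
  apply/measurable_EFinP; apply: measurable_funM.
    exact: (measurableT_comp mh measurable_fst).
  exact: (measurableT_comp (measurable_indicator t) measurable_snd).
have q0 w n : 0 <= q w n by exact: ler01.
have mq : measurable_fun setT (fun wn : Hist T * nat => q wn.1 wn.2).
  exact: measurable_cst.
have mo : measurable_fun setT (o : Omega -> nat) by [].
have oc E A : measurable E -> measurable A ->
  (P ((id : Omega -> Hist T) @^-1` E `&` o @^-1` A) =
   \int[P]_(w in (id : Omega -> Hist T) @^-1` E) density_law (distribution P o) (q w) A)%E.
  move=> mE mA; have hE : history a z v T E by rewrite -history_closed.
  rewrite (output_indep output)//.
  have -> : (fun w => density_law (distribution P o) (q w) A) = cst (P (o @^-1` A)).
    apply/funext => w; transitivity (\int[distribution P o]_(n in A) cst 1 n)%E => //.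
    by rewrite integral_cst// mul1e.
  by rewrite integral_cst; [rewrite muleC|exact: (history_measurable (leqnn T))].
have := @disintegration _ _ _ _ _ _ _ P (distribution P o) (id : Omega -> Hist T) o q
  mX mo q0 mq oc f mf.
rewrite /f /= => ->; last by move=> wn; rewrite lee_fin mulr_ge0.
rewrite -ge0_integralZl//=; first last.
- by move=> w _; rewrite lee_fin.
- by apply/measurable_EFinP; apply: (measurable_Hist_Omega (leqnn T)).
apply: eq_integral => w _.
have -> : (fun n : nat => (h w * (n == t)%:R)%:E * (q w n)%:E)%E =
    (fun n => (h w)%:E * (\1_[set t] n)%:E)%E.
  apply/funext => n; rewrite /q mule1 EFinM indicE; congr (_ * _%:R%:E)%E.
  by congr nat_of_bool; apply/idP/idP; rewrite inE => /eqP.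
rewrite ge0_integralZl//; last by rewrite lee_fin.
rewrite integral_indic// setIT muleC; congr (_ * _)%E.
exact: (output_uniform output tT).
Qed.

(** The bounds of fw_gap_le are summed over the iterations: the values of F telescope
    to at most 2 B, and the mean errors add up to at most (3/2) sqrt(C) T^(2/3). *)
Lemma sfw_gap_expectation :
  (\int[P]_w (fw_gap K F (x (o w) w))%:E <=
    ((2 * B + 3 / 2 * Num.sqrt C * D) * inv_cbrt R T
     + Lbar * D ^+ 2 / 2 * inv_cbrt R T ^+ 2)%:E)%E.
Proof.
have TR : (0 : R) < T%:R by rewrite ltr0n.
pose r := index_iota 1 T.+1.
have rP t : t \in r -> (1 <= t <= T)%N by rewrite mem_index_iota ltnS.
have h0 t w : t \in r -> 0 <= gap_bound t w.
  by move=> /rP tT; have /andP[g0 /(le_trans g0)] := fw_gap_le w tT.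
have /choice[m hm] : forall t, exists mt, t \in r ->
    has_expectation (fun w => enorm (grad_error t w) ^+ 2) mt
    /\ mt <= C * inv_cbrt R t ^+ 2.
  move=> t.
  case: (boolP (t \in r)) => [/rP tT|_]; last by exists 0.
  by have [mt ? ?] := grad_error_mean_sqr tT; exists mt.
pose c := Lbar / 2 * eta_T * D ^+ 2.
pose err t w := D / 2 * (enorm (grad_error t w) ^+ 2 / rate t + rate t).
have err_mean t : t \in r -> has_expectation (err t) (D / 2 * (m t / rate t + rate t)).
  move=> tr; apply: has_meanZ; apply: has_meanD; last exact: has_expectation_cst.
  under [X in has_mean _ _ X _]eq_fun do rewrite mulrC.
  by rewrite mulrC; apply: has_meanZ; case: (hm t tr).
have D_le t w : t \in r -> D * enorm (grad_error t w) <= err t w.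
  move=> /rP /andP[t0 _]; have := ler_wpM2l D0 (enorm_le_rate (grad_error t w) (rate_gt0 t0)).
  by rewrite /err; lra.
have FB s w : (1 <= s <= T.+1)%N -> - B <= F (x s w) <= B.
  by move=> sT; rewrite -ler_norml; apply: (objective_bound bm); exact: run_in_K.
have dF s s' w : (1 <= s <= T.+1)%N -> (1 <= s' <= T.+1)%N ->
    (F (x s w) - F (x s' w)) / eta_T <= 2 * B / eta_T.
  move=> sT s'T; rewrite ler_pM2r ?invr_gt0//.
  by have := FB s w sT; have := FB s' w s'T; lra.
have /choice[mu_ hmu] : forall t, exists mt, t \in r -> has_expectation (gap_bound t) mt.
  move=> t.
  case: (boolP (t \in r)) => [tr|_]; last by exists 0.
  have tT := rP _ tr.
  have hk := has_meanD (has_meanD (has_expectation_cst (2 * B / eta_T)) (err_mean t tr))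
     (has_expectation_cst c).
  have [|||mt ? _] := @has_expectation_of_le (gap_bound t)
    (2 * B / eta_T + D / 2 * (m t / rate t + rate t) + c); last by exists mt.
  - exact: (measurable_Hist_Omega (leqnn T) (measurable_gap_bound tT)).
  - by move=> w; exact: h0.
  - rewrite -(has_mean_expectation hk) expectationE; apply: ge0_le_integralT => w.
      by rewrite lee_fin h0.
    rewrite lee_fin lerD2r; apply: lerD; last exact: D_le.
    by apply: dF; move: tT; clear; lia.
have /choice[nu hnu] : forall t, exists nt, t \in r ->
    has_expectation (fun w => gap_bound t w * (o w == t)%:R) nt /\ nt <= T%:R^-1 * mu_ t.
  move=> t.
  case: (boolP (t \in r)) => [tr|_]; last by exists 0.
  have tT := rP _ tr.
  have [|||nt ? ?] := @has_expectation_of_le (fun w => gap_bound t w * (o w == t)%:R)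
    (T%:R^-1 * mu_ t); last by exists nt.
  - apply: measurable_funM.
      exact: (measurable_Hist_Omega (leqnn T) (measurable_gap_bound tT)).
    exact: (measurableT_comp (measurable_indicator t)).
  - by move=> w; rewrite mulr_ge0// h0.
  - rewrite expectation_index//; [|by move=> w; exact: h0|exact: measurable_gap_bound].
    by rewrite -expectationE (has_mean_expectation (hmu t tr)) EFinM.
have hsum := has_mean_sum (fun t tr => (hnu t tr).1).
apply: (@le_trans _ _ (density_expectation P (fun=> 1)
   (fun w => \sum_(t <- r) gap_bound t w * (o w == t)%:R))).
  rewrite expectationE; apply: ge0_le_integralT => w;
    have /andP[g0 gle] := fw_gap_le w (output_range output w); rewrite lee_fin//.
  have ow : o w \in r by rewrite mem_index_iota ltnS; exact: (output_range output).
  rewrite (bigD1_seq (o w) ow (iota_uniq _ _)) /=.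
  have -> : (o w == o w)%:R = 1 :> R by rewrite eqxx.
  rewrite [X in X + _]mulr1 [X in _ + X]big1; first by rewrite addr0.
  by move=> t; rewrite eq_sym => /negbTE ->; rewrite mulr0.
rewrite (has_mean_expectation hsum) lee_fin.
have nu_mu : \sum_(t <- r) nu t <= T%:R^-1 * \sum_(t <- r) mu_ t.
  by rewrite mulr_sumr !big_seq; apply: ler_sum => t tr; have [] := hnu t tr.
apply: le_trans nu_mu _.
have tele (f : nat -> R) : \sum_(t <- r) (f t - f t.+1) = f 1%N - f T.+1.
  have := @telescope_sumr R 1 T.+1 (fun n => - f n) isT.
  rewrite opprK (addrC (- _)) => <-; apply: eq_bigr => t _.
  by rewrite opprK addrC.
have mu_sum : \sum_(t <- r) mu_ t <=
    2 * B / eta_T + (\sum_(t <- r) (D / 2 * (m t / rate t + rate t)) + T%:R * c).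
  have hR := has_meanD (has_expectation_cst (2 * B / eta_T))
     (has_meanD (has_mean_sum err_mean) (has_expectation_cst (T%:R * c))).
  apply: (has_mean_le one0 (has_mean_sum hmu) hR) => w.
  have -> : \sum_(t <- r) gap_bound t w = (F (x 1 w) - F (x T.+1 w)) / eta_T
      + (\sum_(t <- r) D * enorm (grad_error t w) + T%:R * c).
    rewrite -(tele (fun t => F (x t w))) mulr_suml [T%:R * c]mulr_natl.
    have -> : c *+ T = \sum_(t <- r) c by rewrite /r sumr_const_nat subn1.
    by rewrite -!big_split/=; apply: eq_bigr => t _; rewrite addrA.
  apply: lerD; first by apply: dF; clear; lia.
  rewrite lerD2r !big_seq; apply: ler_sum => t tr; exact: D_le.
have iT0 : 0 <= T%:R^-1 :> R by rewrite invr_ge0 ltW.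
apply: le_trans (ler_wpM2l iT0 mu_sum) _.
have rate_sum : \sum_(t <- r) (D / 2 * (m t / rate t + rate t)) <=
    D * (Num.sqrt C * (3 / 2 * (T%:R * inv_cbrt R T))).
  apply: (@le_trans _ _ (\sum_(t <- r) D * (Num.sqrt C * inv_cbrt R t))).
    rewrite !big_seq; apply: ler_sum => t tr.
    have /andP[t0 _] := rP _ tr; have rt0 := rate_gt0 t0.
    have : m t / rate t <= rate t.
      by rewrite ler_pdivrMr// -expr2 rate_sqr; case: (hm t tr).
    by move=> /(ler_wpM2l D0); rewrite /rate; lra.
  rewrite -mulr_sumr -mulr_sumr; apply: ler_wpM2l => //; apply: ler_wpM2l.
    exact: sqrtr_ge0.
  exact: sum_inv_cbrt_le.
have := ler_wpM2l iT0 rate_sum.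
set th := inv_cbrt R T; have th0 : 0 < th by exact: inv_cbrt_gt0.
have TE : T%:R = th ^- 3 by rewrite inv_cbrt_cube// invrK.
have thE : th ^+ 3 = T%:R^-1 by rewrite TE invrK.
have e1 : T%:R^-1 * (2 * B / th ^+ 2) = 2 * B * th.
  by rewrite -thE; field; rewrite gt_eqF.
have e2 : T%:R^-1 * (D * (Num.sqrt C * (3 / 2 * (T%:R * th)))) =
    3 / 2 * Num.sqrt C * D * th by field; rewrite gt_eqF.
have e3 : T%:R^-1 * (T%:R * c) = Lbar * D ^+ 2 / 2 * th ^+ 2.
  by rewrite /c -/th; field; rewrite gt_eqF.
by rewrite !mulrDr e1 e2 e3; lra.
Qed.

End run.

(** * The convergence rate *)

Theorem theorem2 (R : realType) (d : nat)
  (dZ : measure_display) (Z : measurableType dZ)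
  (mu : {sigma_finite_measure set Z -> \bar R})
  (Ft : 'cV[R]_d -> Z -> R) (p : Z -> 'cV[R]_d -> R)
  (F : 'cV[R]_d -> R) (K : set 'cV[R]_d)
  (K_nonempty : K !=set0) (K_convex : convex_set K) (K_compact : compact K)
  (model : nonoblivious_model mu Ft p K F)
  (B GF GP LF LP : R)
  (GP_ge0 : 0 <= GP) (LP_ge0 : 0 <= LP)
  (Ft_bound : forall x z, K x -> `|Ft x z| <= B)
  (grad_Ft_bound : forall x z, K x -> enorm (grad (Ft^~ z) x) <= GF)
  (grad_logp_bound : forall x, K x ->
    (density_expectation mu (p^~ x) (fun z => enorm (grad (logp p z) x) ^+ 4)%R
       <= (GP ^+ 4)%:E)%E)
  (hess_Ft_bound : forall x z, K x -> specnorm (hess (Ft^~ z) x) <= LF)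
  (hess_logp_bound : forall x, K x ->
    (density_expectation mu (p^~ x) (fun z => specnorm (hess (logp p z) x) ^+ 2)%R
       <= (LP ^+ 2)%:E)%E)
  (dO : measure_display) (Omega : measurableType dO) (P : probability Omega R)
  (T : nat) (T_ge1 : (1 <= T)%N)
  (x1 : 'cV[R]_d) (x1K : K x1) (rho eta : nat -> R)
  (rhoE : forall t, (2 <= t <= T)%N -> rho t = (t.-1)%:R `^ (- (2 / 3)))
  (etaE : forall t, (1 <= t <= T)%N -> eta t = T%:R `^ (- (2 / 3)))
  (a : nat -> {RV P >-> R}) (z : nat -> {RV P >-> Z})
  (x g v : nat -> Omega -> 'cV[R]_d)
  (run : sfw_run a z v mu Ft p K x1 rho eta T x g)
  (o : {RV P >-> nat}) (output : uniform_output_index a z v T o) :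
  let D := diameter K in
  let G := Num.max GF GP in
  let L := Num.max LF LP in
  let Lbar := Num.sqrt (4 * B ^+ 2 * G ^+ 4 + 16 * G ^+ 4 + 4 * L ^+ 2
                        + 4 * B ^+ 2 * L ^+ 2) in
  let kappa := 4 / 3 - 2 `^ (- (2 / 3)) in
  let C := Num.max (2 * (2 * G + D * Lbar) ^+ 2 / kappa)
             (Num.max ((2 / kappa) ^+ 4) ((2 * D * (Lbar + L)) ^+ 4)) in
  let x_o := fun w => x (o w) w in
  (forall w, K (x_o w)) /\
  ('E_P[fun w => fw_gap K F (x_o w)] <=
    ((2 * B + 3 / 2 * Num.sqrt C * D) / T%:R `^ (1 / 3)
     + Lbar * D ^+ 2 / (2 * T%:R `^ (2 / 3)))%:E)%E.
Proof.
move=> D G L Lbar kappa C x_o.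
have GF0 : 0 <= GF := le_trans (enorm_ge0 _) (grad_Ft_bound x1 point x1K).
have bm : bounded_model mu Ft p F K B G L.
  split => //.
  - by move=> y s Ky; rewrite le_max grad_Ft_bound.
  - move=> y Ky; apply: le_trans (grad_logp_bound y Ky) _.
    by rewrite lee_fin ler_pXn2r ?nnegrE// ?le_max ?GF0// lexx orbT.
  - by move=> y s Ky; rewrite le_max hess_Ft_bound.
  - move=> y Ky; apply: le_trans (hess_logp_bound y Ky) _.
    by rewrite lee_fin ler_pXn2r ?nnegrE// ?le_max ?LP_ge0 ?orbT// lexx orbT.
have rhoE' t : (2 <= t <= T)%N -> rho t = inv_cbrt R t.-1 ^+ 2.
  by move=> tT; rewrite inv_cbrt_sqr rhoE.
have etaE' t : (1 <= t <= T)%N -> eta t = inv_cbrt R T ^+ 2.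
  by move=> tT; rewrite inv_cbrt_sqr etaE.
have sqr01 n : (0 < n)%N -> 0 <= inv_cbrt R n ^+ 2 <= 1.
  move=> n0; rewrite sqr_ge0 expr_le1 ?powR_ge0//.
  by rewrite -(@inv_cbrt1 R); apply: inv_cbrt_le.
have rho01 t : (2 <= t <= T)%N -> 0 <= rho t <= 1.
  by move=> tT; rewrite rhoE'// sqr01//; case: t tT => [|[]].
have eta01 t : (1 <= t <= T)%N -> 0 <= eta t <= 1.
  by move=> tT; rewrite etaE'// sqr01.
split.
  move=> w; apply: (run_in_K bm x1K run eta01).
  have /andP[-> oT] := output_range output w; exact: leqW.
rewrite unlock.
have kE : 4 / 3 - inv_cbrt R 2 ^+ 2 = kappa by rewrite inv_cbrt_sqr.
have th0 : 0 < inv_cbrt R T by exact: inv_cbrt_gt0.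
have -> : ((2 * B + 3 / 2 * Num.sqrt C * D) / T%:R `^ (1 / 3)
     + Lbar * D ^+ 2 / (2 * T%:R `^ (2 / 3)))
  = (2 * B + 3 / 2 * Num.sqrt C * D) * inv_cbrt R T
     + Lbar * D ^+ 2 / 2 * inv_cbrt R T ^+ 2.
  by rewrite inv_cbrt_sqr /inv_cbrt !powRN invfM !mulrA.
apply: (sfw_gap_expectation bm x1K run rho01 eta01 K_compact T_ge1 rhoE' etaE' _ _ _ output).
- by rewrite kE /C le_max lexx.
- by rewrite kE /C !le_max lexx orbT.
- by rewrite /C !le_max lexx !orbT.
Qed.
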